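(* The graph isomorphism problem restricted to literal-clause graphs with negation connections of 3-SAT formulas is equally hard as graph isomorphism on general graphs: $\mathrm{GI}$ is polynomial-time many-one reducible to $\mathrm{GI}_{\mathrm{SAT}}$, and $\mathrm{GI}_{\mathrm{SAT}}$ is polynomial-time many-one reducible to $\mathrm{GI}$.
   Context: $\mathrm{GI}=\{(G,H): G,H\text{ are isomorphic graphs}\}$. For a CNF formula $f$ on variables $x_1,\dots,x_n$, $\mathrm{LCN}(f)$ is the edge-colored graph with vertices the $2n$ literals $x_i,\neg x_i$ and one vertex per clause, a ''literal-clause'' colored edge $\{\ell,c\}$ whenever $\ell\in c$, and a differently colored ''literal-literal'' edge $\{x_i,\neg x_i\}$ for each $i$. A 3-SAT formula is a CNF formula with every clause of at most 3 literals. With $\mathcal G=\{\mathrm{LCN}(f): f\text{ a 3-SAT formula}\}$, $\mathrm{GI}_{\mathrm{SAT}}=\{(G,H): G,H\in\mathcal G\text{ are isomorphic (as edge-colored graphs)}\}$. *)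

(* Defs.v *)
From mathcomp Require Import all_boot.
Set Implicit Arguments. Unset Strict Implicit. Unset Printing Implicit Defensive.

(* 1. Machine model: deterministic single-tape Turing machines with a   *)
(*    two-way infinite tape.  Tape alphabet 'I_(G.+3): symbol 0 = blank,*)
(*    1 = bit false, 2 = bit true, others are work symbols.             *)

Inductive move := MoveL | MoveR | Stay.

Record TM := {
  tm_Q : nat;
  tm_G : nat;
  tm_start : 'I_tm_Q.+1;
  tm_delta : 'I_tm_Q.+1 -> 'I_tm_G.+3 ->
             option ('I_tm_Q.+1 * 'I_tm_G.+3 * move) (* None = halt *)
}.

(* configuration: state, tape left of head (nearest cell first),
   scanned symbol, tape right of head (nearest cell first) *)
Record config (M : TM) := Config {
  c_state : 'I_(tm_Q M).+1;
  c_left : seq 'I_(tm_G M).+3;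
  c_head : 'I_(tm_G M).+3;
  c_right : seq 'I_(tm_G M).+3 }.

Definition blank {G : nat} : 'I_G.+3 := ord0.

Definition step (M : TM) (c : config M) : option (config M) :=
  match tm_delta (c_state c) (c_head c) with
  | None => None
  | Some (q, s, mv) =>
    Some match mv with
    | Stay => Config q (c_left c) s (c_right c)
    | MoveL => match c_left c with
               | [::] => Config q [::] blank (s :: c_right c)
               | x :: l => Config q l x (s :: c_right c)
               end
    | MoveR => match c_right c with
               | [::] => Config q (s :: c_left c) blank [::]
               | x :: r => Config q (s :: c_left c) x r
               end
    end
  end.

Fixpoint run (M : TM) (k : nat) (c : config M) : option (config M) :=
  match step c with
  | None => Some c
  | Some c' => if k is k'.+1 then run k' c' else None
  end.

Definition sym_of_bit {G : nat} (b : bool) : 'I_G.+3 :=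
  if b then inord 2 else inord 1.

Definition init (M : TM) (w : seq bool) : config M :=
  match w with
  | [::] => Config (tm_start M) [::] blank [::]
  | b :: w' => Config (tm_start M) [::] (sym_of_bit b) (map sym_of_bit w')
  end.

Fixpoint read_bits {G : nat} (s : seq 'I_G.+3) : seq bool :=
  match s with
  | [::] => [::]
  | x :: s' => if val x == 1 then false :: read_bits s'
               else if val x == 2 then true :: read_bits s'
               else [::]
  end.

Definition output (M : TM) (c : config M) : seq bool :=
  read_bits (c_head c :: c_right c).

Definition poly_time_computable (f : seq bool -> seq bool) : Prop :=
  exists (M : TM) (d : nat), forall w : seq bool,
    exists c, run ((size w) ^ d + d) (init M w) = Some c /\ output c = f w.

Definition language := seq bool -> Prop.

Definition poly_reducible (L1 L2 : language) : Prop :=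
  exists f, poly_time_computable f /\ forall w, L1 w <-> L2 (f w).

Definition simple_graph (n : nat) (A : 'I_n -> 'I_n -> bool) : Prop :=
  (forall i j, A i j = A j i) /\ (forall i, A i i = false).

Definition graph_iso (n m : nat) (A : 'I_n -> 'I_n -> bool)
    (B : 'I_m -> 'I_m -> bool) : Prop :=
  exists f : 'I_n -> 'I_m, bijective f /\ forall i j, A i j = B (f i) (f j).

Definition enc_graph (n : nat) (A : 'I_n -> 'I_n -> bool) : seq bool :=
  nseq n true ++ false :: [seq A i j | i <- enum 'I_n, j <- enum 'I_n].

Definition GI : language := fun w =>
  exists n m (A : 'I_n -> 'I_n -> bool) (B : 'I_m -> 'I_m -> bool),
    w = enc_graph A ++ enc_graph B /\
    simple_graph A /\ simple_graph B /\ graph_iso A B.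

(* edge-colored graphs: C i j = 0 means no edge, 1 a "literal-clause"
   edge, 2 a "literal-literal" edge; C symmetric with zero diagonal *)
Definition colored_graph (n : nat) (C : 'I_n -> 'I_n -> 'I_3) : Prop :=
  (forall i j, C i j = C j i) /\ (forall i, C i i = ord0).

Definition cgraph_iso (n m : nat) (C : 'I_n -> 'I_n -> 'I_3)
    (D : 'I_m -> 'I_m -> 'I_3) : Prop :=
  exists f : 'I_n -> 'I_m, bijective f /\ forall i j, C i j = D (f i) (f j).

Definition enc_color (c : 'I_3) : seq bool := [:: val c == 1; val c == 2].

Definition enc_cgraph (n : nat) (C : 'I_n -> 'I_n -> 'I_3) : seq bool :=
  nseq n true ++ false ::
    flatten [seq enc_color (C i j) | i <- enum 'I_n, j <- enum 'I_n].

(* A CNF formula on variables x_1..x_n is a sequence of clauses; a clause *)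
(* is a sequence of literals (v, b) : 'I_n * bool, meaning x_v if b is    *)
(* false and ~x_v if b is true.                                           *)

Definition is_3SAT (n : nat) (cls : seq (seq ('I_n * bool))) : bool :=
  all (fun c => size (undup c) <= 3) cls.

(* vertex numbering of LCN: literal x_v is vertex 2v, ~x_v is 2v+1,
   clause number k is vertex 2n + k *)
Definition lit_index (n : nat) (l : 'I_n * bool) : nat := 2 * val l.1 + l.2.

Definition LCN_col_nat (n : nat) (cls : seq (seq ('I_n * bool))) (i j : nat)
  : nat :=
  if (i < 2 * n) && (j < 2 * n) then
    (if (i != j) && (i./2 == j./2) then 2 else 0)
  else if (i < 2 * n) && (2 * n <= j) then
    (if has (fun l => lit_index l == i) (nth [::] cls (j - 2 * n)) then 1 else 0)
  else if (2 * n <= i) && (j < 2 * n) then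
    (if has (fun l => lit_index l == j) (nth [::] cls (i - 2 * n)) then 1 else 0)
  else 0.

Definition LCN (n : nat) (cls : seq (seq ('I_n * bool))) :
    'I_(2 * n + size cls) -> 'I_(2 * n + size cls) -> 'I_3 :=
  fun i j => inord (LCN_col_nat cls i j).
Arguments LCN {n} cls.

Definition GI_SAT : language := fun w =>
  exists n m (C : 'I_n -> 'I_n -> 'I_3) (D : 'I_m -> 'I_m -> 'I_3),
    w = enc_cgraph C ++ enc_cgraph D /\
    (exists k (f : seq (seq ('I_k * bool))), is_3SAT f /\ cgraph_iso C (LCN f)) /\
    (exists k (g : seq (seq ('I_k * bool))), is_3SAT g /\ cgraph_iso D (LCN g)) /\
    cgraph_iso C D.

(* Main.v *)
(** From a graph to a formula: take a variable per vertex and, for every ordered pair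
    [(i, k)], the clause {x_i, x_k} if [ik] is an edge and an empty clause otherwise.
    An isomorphism of the literal-clause graphs preserves literals (the vertices with a
    literal-literal edge) and complementary pairs, hence permutes the variables, and
    two distinct variables share a clause iff the vertices are adjacent.

    From a formula to a graph: both edge colors are put on separate layers, and the
    layers are recognized by the degrees, because a literal-literal edge is unique at
    each vertex.  Being (isomorphic to) the graph of a 3-SAT formula is a condition that
    can be checked directly on the colored graph.

    Polynomial time: both reductions are programs with loops over input positions
    only, acting on finitely many pointers into the input and emitting output bits.
    Such programs run on a single tape whose cells carry one track per pointer. *)
Require Import Defs.
From mathcomp Require Import all_boot.
From mathcomp Require Import zify.
Set Implicit Arguments. Unset Strict Implicit. Unset Printing Implicit Defensive.

(** * Structured tape programs *)

(** Empty clauses for non-edges fix the vertex set of the target as the product of [n] and [n + 2],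
    so its matrix is emitted by plain nested loops, without counting edges or ranking clauses. The
    price is symmetry: clause vertices of non-edges are isolated, and a variable of an isolated
    vertex can be swapped with its negation. In the other direction, vertices off layer 0 can be
    permuted. An isomorphism of targets therefore need not come from one of the sources, and edges
    must be recovered from isomorphism-invariant properties. A many-one reduction is total, so both
    programs first validate their input and send every rejected word to the empty word, which lies
    in neither language. Numbers are handled in unary: the value of [Let] is the number of bits its
    subprogram emits, so sequencing adds and nesting of loops multiplies. A value that runs off the
    tape loses its mark; offsets computed from such values are used only after a check that the
    blocks fit the input. *)

Section TapePrograms.
Variable X : finType.

Notation sym := (option bool + X)%type.

Definition tape := (seq sym * sym * seq sym)%type.

Definition mk_tape (l r : seq sym) : tape := (l, head (inl None) r, behead r).

Definition move_head (d : move) (y : sym) (T : tape) : tape :=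
  let: (l, _, r) := T in
  match d with
  | Stay => (l, y, r)
  | MoveL => mk_tape (behead l) (head (inl None) l :: y :: r)
  | MoveR => mk_tape (y :: l) r
  end.

(* A program exits with a code in [option bool]: [Cond] branches on [Some true],
   and [Loop] runs its body again exactly when the body exits with [None]. *)
Inductive tprog :=
  | Act of (sym -> option bool * sym * move)
  | Cond of tprog & tprog & tprog
  | Loop of tprog.

Fixpoint tstate (p : tprog) : finType :=
  match p with
  | Act _ => unit
  | Cond t p q => (tstate t + (tstate p + tstate q))%type
  | Loop p => tstate p
  end.

Fixpoint tstart (p : tprog) : tstate p :=
  match p with
  | Act _ => tt
  | Cond t p q => inl (tstart t)
  | Loop p => tstart p
  end.

Fixpoint tdelta (p : tprog) {struct p} :
    tstate p -> sym -> (tstate p + option bool) * sym * move :=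
  match p with
  | Act f => fun _ x => let: (b, y, d) := f x in (inr b, y, d)
  | Cond t p q => fun s x =>
    match s with
    | inl s => let: (r, y, d) := @tdelta t s x in
      (inl match r with
           | inl s' => inl s'
           | inr b => inr (if b == Some true then inl (tstart p)
                           else inr (tstart q))
           end, y, d)
    | inr (inl s) => let: (r, y, d) := @tdelta p s x in
      (match r with inl s' => inl (inr (inl s')) | inr b => inr b end, y, d)
    | inr (inr s) => let: (r, y, d) := @tdelta q s x in
      (match r with inl s' => inl (inr (inr s')) | inr b => inr b end, y, d)
    end
  | Loop p => fun s x =>
    let: (r, y, d) := @tdelta p s x in
    (match r with
     | inl s' => inl s'
     | inr None => inl (tstart p)
     | inr b => inr b
     end, y, d)
  end.

Inductive steps (p : tprog) : tstate p -> tape -> nat -> option bool -> tape -> Prop :=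
  | steps_exit s T b y d :
      tdelta s T.1.2 = (inr b, y, d) -> steps s T 1 b (move_head d y T)
  | steps_next s T s' y d k b T' :
      tdelta s T.1.2 = (inl s', y, d) -> steps s' (move_head d y T) k b T' ->
      steps s T k.+1 b T'.

Definition runs p T k b T' := exists2 j, j <= k & steps (tstart p) T j b T'.

Lemma runsW k k' p T b T' : k <= k' -> runs p T k b T' -> runs p T k' b T'.
Proof. by move=> kk' [j jk h]; exists j => //; apply: leq_trans kk'. Qed.

Lemma runs_act f T k b y d T' :
  f T.1.2 = (b, y, d) -> move_head d y T = T' -> 0 < k -> runs (Act f) T k b T'.
Proof. by move=> fE <- k0; exists 1 => //; apply: steps_exit => /=; rewrite fE. Qed.

(** The transition that leaves the test already enters the start state of a branch, so the costs add
    up without overhead. *)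
Lemma runs_cond t p q k1 k2 k T b T1 b' T2 :
  runs t T k1 b T1 -> runs (if b == Some true then p else q) T1 k2 b' T2 ->
  k1 + k2 <= k -> runs (Cond t p q) T k b' T2.
Proof.
move=> [j1 jk1 h1] [j2 jk2 h2] kk.
exists (j1 + j2); first by apply: leq_trans kk; apply: leq_add.
rewrite /=; elim: h1 h2 => {j1 jk1 T b T1} [s T b y d e|s T s1 y d j b T1 e _ IH] h2.
  rewrite add1n; apply: steps_next; first by rewrite /= e.
  have {}h2 : steps (p := Cond t p q)
      (inr (if b == Some true then inl (tstart p) else inr (tstart q)))
      (move_head d y T) j2 b' T2; last exact: h2.
  case: eqP h2 => _ h2.
    elim: h2 => {e} [s0 T0 b0 y0 d0 e|s0 T0 s1 y0 d0 j0 b0 T0' e _ IH].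
      by apply: steps_exit; rewrite /= e.
    by apply: steps_next IH; rewrite /= e.
  elim: h2 => {e} [s0 T0 b0 y0 d0 e|s0 T0 s1 y0 d0 j0 b0 T0' e _ IH].
    by apply: steps_exit; rewrite /= e.
  by apply: steps_next IH; rewrite /= e.
by rewrite addSn; apply: steps_next (IH h2); rewrite /= e.
Qed.

Lemma runs_loop_exit p k T b T' :
  runs p T k (Some b) T' -> runs (Loop p) T k (Some b) T'.
Proof.
move=> [j jk h]; exists j => //=.
move: h; move eb: (Some b) => ob h.
elim: h eb => {jk T ob T'} [s T ob y d e|s T s1 y d j0 ob T' e _ IH] eb.
  by apply: (@steps_exit (Loop p)); rewrite /= e -eb.
by apply: (@steps_next (Loop p)) (IH eb); rewrite /= e.
Qed.

Lemma runs_loop_next p k1 k2 k T T1 b T2 :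
  runs p T k1 None T1 -> runs (Loop p) T1 k2 b T2 -> k1 + k2 <= k ->
  runs (Loop p) T k b T2.
Proof.
move=> [j1 jk1 h1] [j2 jk2 h2] kk.
exists (j1 + j2); first by apply: leq_trans kk; apply: leq_add.
change (@steps (Loop p) (tstart p) T (j1 + j2) b T2).
move: h1; move eb: None => ob h1.
elim: h1 eb h2 => {j1 jk1 T ob T1} [s T ob y d e|s T s1 y d j ob T1 e _ IH] eb h2.
  by rewrite add1n; apply: (@steps_next (Loop p)) h2; rewrite /= e -eb.
by rewrite addSn; apply: (@steps_next (Loop p)) (IH eb h2); rewrite /= e.
Qed.

(** The first three codes are those that the machine model fixes for blank, false and true. *)
Definition code_sym (x : sym) : 'I_#|X|.+3 :=
  match x with
  | inl None => ord0
  | inl (Some b) => inord (1 + b)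
  | inr c => inord (3 + enum_rank c)
  end.

Arguments code_sym : simpl never.

Definition decode_sym (i : 'I_#|X|.+3) : sym :=
  if val i is k.+3 then
    if insub k is Some j then inr (enum_val (j : 'I_#|X|)) else inl None
  else if val i == 0 then inl None else inl (Some (val i == 2)).

Lemma val_code_sym x : val (code_sym x) =
  match x with
  | inl None => 0 | inl (Some b) => 1 + b | inr c => 3 + enum_rank c
  end.
Proof.
case: x => [[b|]|c] //=; rewrite inordK //; first by case: b.
exact: (leq_add (leqnn 3) (ltn_ord (enum_rank c))).
Qed.

Lemma code_symK : cancel code_sym decode_sym.
Proof.
move=> x; rewrite /decode_sym val_code_sym.
case: x => [[[]|]|c] //=.
rewrite insubT ?ltn_ord // => h; congr inr; rewrite -[RHS]enum_rankK; congr enum_val; exact: val_inj.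
Qed.

Lemma code_bit b : code_sym (inl (Some b)) = sym_of_bit b.
Proof. by apply: val_inj; rewrite val_code_sym /sym_of_bit; case: b => /=; rewrite inordK. Qed.

(** * Tape programs as Turing machines *)

Section Machine.
Variable p : tprog.

(** The extra index [ord_max] is a halting state: it decodes to [None], where the machine has no
    transition. The exit code of the whole program is dropped. *)
Definition code_state (s : option (tstate p)) : 'I_#|tstate p|.+1 :=
  if s is Some s then widen_ord (leqnSn _) (enum_rank s) else ord_max.

Definition decode_state (i : 'I_#|tstate p|.+1) : option (tstate p) :=
  omap enum_val (insub (val i) : option 'I_#|tstate p|).

Lemma code_stateK : cancel code_state decode_state.
Proof.
case=> [s|]; rewrite /decode_state /=; last by rewrite insubF ?ltnn.
by rewrite (insubT (fun i => i < #|tstate p|)) //= => h; rewrite -[in RHS](enum_rankK s);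
  congr (Some (enum_val _)); apply: val_inj.
Qed.

Definition machine : TM := {|
  tm_Q := #|tstate p|;
  tm_G := #|X|;
  tm_start := code_state (Some (tstart p));
  tm_delta := fun q a =>
    if decode_state q is Some s then
      let: (r, y, d) := tdelta s (decode_sym a) in
      Some (code_state (if r is inl s' then Some s' else None), code_sym y, d)
    else None |}.

Definition conf (s : option (tstate p)) (T : tape) : config machine :=
  @Config machine (code_state s) (map code_sym T.1.1) (code_sym T.1.2)
    (map code_sym T.2).

Lemma step_conf s T r y d : tdelta s T.1.2 = (r, y, d) ->
  step (conf (Some s) T) =
  Some (conf (if r is inl s' then Some s' else None) (move_head d y T)).
Proof.
move=> e; rewrite /step /= -/(code_state (Some s)) code_stateK code_symK e.
case: T e => [[l x] r'] _ /=; congr Some.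
by case: d => //=; [case: l | case: r'].
Qed.

(** Surplus fuel is harmless, so an upper bound on the number of steps is enough. *)
Lemma run_halted k T : run k (conf None T) = Some (conf None T).
Proof. have h : step (conf None T) = None by rewrite /step /= -[ord_max]/(code_state None) code_stateK.
by case: k => [|k]; rewrite [LHS]/= h. Qed.

Lemma runs_machine T k b T' : runs p T k b T' ->
  run k (conf (Some (tstart p)) T) = Some (conf None T').
Proof.
move=> [j jk h]; elim: h k jk => {b T'} [s {}T b y d e|s {}T s' y d {}j b T' e _ IH] [|k] // jk;
  rewrite [LHS]/= (step_conf e); first exact: run_halted.
exact: IH.
Qed.

Lemma init_conf w :
  init machine w = conf (Some (tstart p)) (mk_tape [::] (map (inl \o Some) w)).
Proof.
case: w => [|b w] //; rewrite /init /conf /= -map_comp.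
congr Config; first exact/esym/code_bit.
by apply: eq_map => c; exact/esym/code_bit.
Qed.

Lemma read_code o z : (if z is inl (Some _) :: _ then false else true) ->
  read_bits (map code_sym (map (inl \o Some) o ++ z)) = o.
Proof.
move=> hz; elim: o => [|b o IH].
  by case: z hz => [|[[b|]|c] z] //= _; rewrite val_code_sym.
by rewrite [LHS]/= val_code_sym /= IH; case: b.
Qed.

Lemma output_conf l o z : (if z is inl (Some _) :: _ then false else true) ->
  output (conf None (mk_tape l (map (inl \o Some) o ++ z))) = o.
Proof.
move=> /(read_code o); case: (_ ++ z) => [|x r] //=.
Qed.

End Machine.
End TapePrograms.

(** * Programs over pointers into the input *)

Inductive test :=
  | Bit of nat
  | In of nat
  | Lt of nat & nat
  | Eq of nat & nat.

Inductive prog :=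
  | Ret of bool
  | Test of test
  | Emit of bool
  | If of prog & prog & prog
  | For of nat & prog
  | Let of nat & prog & prog.

Definition upd (s : nat -> nat) x v : nat -> nat :=
  fun y => if eqn y x then v else s y.

Lemma updE s x v y : upd s x v y = if y == x then v else s y.
Proof. by []. Qed.

Fixpoint foreach (f : nat -> bool * seq bool) (l : seq nat) : bool * seq bool :=
  if l is i :: l' then
    let: (b, o) := f i in
    if b then (true, o) else let: (b', o') := foreach f l' in (b', o ++ o')
  else (false, [::]).

Lemma foreach_cons f i l : foreach f (i :: l) =
  let: (b, o) := f i in
  if b then (true, o) else let: (b', o') := foreach f l in (b', o ++ o').
Proof. by []. Qed.

Section Semantics.
Variable w : seq bool.

Notation B := (size w).+2.

(* A variable is a mark on a track of the cells holding the input and two padding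
   cells; a value [>= B] is an absent mark, hence the guards [s x < B]. *)
Definition sem_test (t : test) (s : nat -> nat) : bool :=
  match t with
  | Bit x => nth false w (s x)
  | In x => s x < size w
  | Lt x y => (s x < s y) && (s x < B)
  | Eq x y => (s x == s y) && (s x < B)
  end.

(* [For] is a bounded search that stops as soon as its body returns [true]; running
   time is polynomial because [For] is the only loop. *)
Fixpoint sem (P : prog) (s : nat -> nat) : bool * seq bool :=
  match P with
  | Ret b => (b, [::])
  | Test t => (sem_test t s, [::])
  | Emit b => (false, [:: b])
  | If P Q R =>
    let: (b, o) := sem P s in
    let: (b', o') := if b then sem Q s else sem R s in (b', o ++ o')
  | For x P => foreach (fun i => sem P (upd s x i)) (iota 0 B)
  | Let x Q P => sem P (upd s x (size (sem Q s).2))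
  end.

End Semantics.

(* The program may read the variables of [X]; those of [R] must be preserved.  [R]
   also contains the counters of the enclosing [Let]s, which are not readable. *)
Fixpoint well_scoped (K : nat) (X R : seq nat) (P : prog) : bool :=
  match P with
  | Ret _ | Emit _ => true
  | Test t => all (mem X) match t with
                          | Bit x | In x => [:: x]
                          | Lt x y | Eq x y => [:: x; y]
                          end
  | If P Q Q' => [&& well_scoped K X R P, well_scoped K X R Q & well_scoped K X R Q']
  | For x P => [&& x \notin R, x <= K & well_scoped K (x :: X) (x :: R) P]
  | Let x Q P => [&& x \notin R, x <= K, well_scoped K X (x :: R) Q &
                     well_scoped K (x :: X) (x :: R) P]
  end.

(** * Compilation of pointer programs to tape programs *)

Section Compiler.
Variable K : nat.

Definition cell := (option bool * {ffun 'I_K.+1 -> bool})%type.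

Notation sym := (option bool + option cell)%type.
Notation tprog := (tprog (option cell)).
Notation tape := (tape (option cell)).

(** Left end marker, where the head rests between instructions. To its right come the cells with
    their tracks, then the output as plain bits, then a blank. *)
Definition hash : sym := inr None.
Definition is_cell (x : sym) := if x is inr (Some _) then true else false.

Definition seqp (p q : tprog) : tprog := Cond p q q.

Definition act (g : sym -> sym) (d : move) : tprog :=
  Act (fun x => (Some true, g x, d)).

Definition exit (b : option bool) : tprog := Act (fun x => (b, x, Stay)).

Definition sweepR (stop : pred sym) (g : sym -> sym) : tprog :=
  Loop (Act (fun x => if stop x then (Some true, x, Stay)
                      else (None, g x, MoveR))).

Definition sweepL (b : bool) : tprog :=
  Loop (Act (fun x => if x == hash then (Some b, x, Stay)
                      else (None, x, MoveL))).

Definition mark (x : nat) (b : bool) (y : sym) : sym :=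
  if y is inr (Some c) then
    inr (Some (c.1, [ffun k => if k == inord x then b else c.2 k]))
  else y.

Definition marked (x : nat) (c : cell) : bool := c.2 (inord x).

(** Stopping at non-cells as well keeps the sweep finite when the mark is absent. *)
Definition stop_at (x : nat) : pred sym :=
  fun y => if y is inr (Some c) then marked x c else true.

Definition clear (x : nat) : tprog :=
  seqp (act id MoveR) (seqp (act (mark x true) MoveR)
    (seqp (sweepR (predC is_cell) (mark x false)) (sweepL true))).

(** From the last cell the mark is moved onto a non-cell, where [mark] is the identity: it vanishes,
    and later increments change nothing. So an absent mark can stand for every value outside the
    tape. *)
Definition incr (x : nat) : tprog :=
  seqp (act id MoveR)
  (seqp (sweepR (stop_at x) id)
  (seqp (Act (fun y => (Some true, mark x false y,
                        if is_cell y then MoveR else Stay)))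
  (seqp (act (mark x true) Stay) (sweepL true)))).

Definition scan_loop (f : cell -> option bool) : tprog :=
  Loop (Act (fun y => if y is inr (Some c) then
                        (f c, y, if f c is None then MoveR else Stay)
                      else (Some false, y, Stay))).

(** The verdict has to survive the return of the head; it is carried by the choice between two
    return sweeps with different exit codes. *)
Definition scan (f : cell -> option bool) : tprog :=
  seqp (act id MoveR) (Cond (scan_loop f) (sweepL true) (sweepL false)).

(** The scan goes from left to right, so the first mark met belongs to the smaller value. Looking
    for [y] before [x] makes [Lt] strict; [In] recognizes padding by the missing bit. *)
Definition scan_test (t : test) (c : cell) : option bool :=
  match t with
  | Bit x => if marked x c then Some (c.1 == Some true) else None
  | In x => if marked x c then Some (isSome c.1) else None
  | Lt x y => if marked y c then Some false
              else if marked x c then Some true else None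
  | Eq x y => if marked x c || marked y c then Some (marked x c && marked y c)
              else None
  end.

Definition write (b : bool) : tprog :=
  seqp (act id MoveR)
  (seqp (sweepR (pred1 (inl None)) id)
  (seqp (act (fun=> inl (Some b)) MoveR) (sweepL false))).

(* The mode [c = Some x] is used inside [Let x]: emitting a bit increments [x]. *)
Fixpoint compile (c : option nat) (P : prog) : tprog :=
  match P with
  | Ret b => exit (Some b)
  | Test t => scan (scan_test t)
  | Emit b => if c is Some x then seqp (incr x) (exit (Some false)) else write b
  | If P Q R => Cond (compile c P) (compile c Q) (compile c R)
  | For x P => seqp (clear x)
     (Loop (Cond (compile c P) (exit (Some true))
        (seqp (incr x)
          (Cond (scan (scan_test (Eq x x))) (exit None) (exit (Some false))))))
  | Let x Q P => seqp (clear x) (seqp (compile (Some x) Q) (compile c P))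
  end.

Section Correct.
Variable w : seq bool.

Notation B := (size w).+2.

Definition cell_at (m : nat -> nat) (i : nat) : cell :=
  (nth None (map Some w) i, [ffun k : 'I_K.+1 => m k == i]).

Definition cells m : seq sym := [seq inr (Some (cell_at m i)) | i <- iota 0 B].

Definition bits (o : seq bool) : seq sym := map (inl \o Some) o.

(* The last blank is kept explicit, so that tapes can be compared literally. *)
Definition home m o : tape :=
  mk_tape [::] (hash :: cells m ++ bits o ++ [:: inl None]).

Lemma runs_seqp p q k1 k2 k T b T1 b' T2 :
  runs p T k1 b T1 -> runs q T1 k2 b' T2 -> k1 + k2 <= k ->
  runs (seqp p q) T k b' T2.
Proof. by move=> h1 h2; apply: (runs_cond h1); case: ifP. Qed.

Lemma runs_sweepR stop g xs r l :
  all (predC stop) xs -> stop (head (inl None) r) ->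
  runs (sweepR stop g) (mk_tape l (xs ++ r)) (size xs).+1 (Some true)
    (mk_tape (rev (map g xs) ++ l) r).
Proof.
elim: xs l => [|x xs IH] l /= => [_ hr|/andP[/negbTE hx hxs] hr].
  by apply: runs_loop_exit; apply: runs_act => //=; rewrite ?hr.
apply: (@runs_loop_next _ _ 1 (size xs).+1).
- by apply: runs_act; rewrite /= ?hx.
- by rewrite rev_cons cat_rcons; apply: IH.
- by [].
Qed.

Lemma runs_sweepL b xs r :
  hash \notin xs -> head (inl None) r != hash ->
  runs (sweepL b) (mk_tape (rev xs ++ [:: hash]) r) (size xs).+2 (Some b)
    (mk_tape [::] (hash :: xs ++ head (inl None) r :: behead r)).
Proof.
elim/last_ind: xs r => [|xs x IH] r /= => [_ hr|].
  apply: (@runs_loop_next _ _ 1 1) => //.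
    by apply: runs_act; rewrite /= ?(negbTE hr).
  by apply: runs_loop_exit; apply: runs_act => //=; rewrite eqxx.
rewrite mem_rcons inE negb_or eq_sym => /andP[hx hxs] hr.
apply: (@runs_loop_next _ _ 1 (size xs).+2); last by rewrite size_rcons.
  by apply: runs_act; rewrite /= ?(negbTE hr).
by rewrite rev_rcons cat_rcons; apply: (IH (x :: head (inl None) r :: behead r)).
Qed.

Lemma runs_sweepLn b xs r k :
  hash \notin xs -> head (inl None) r != hash -> r != [::] -> (size xs).+2 <= k ->
  runs (sweepL b) (mk_tape (rev xs ++ [:: hash]) r) k (Some b) (mk_tape [::] (hash :: xs ++ r)).
Proof. by case: r => // y r hx hy _ hk; apply: (runsW hk); apply: runs_sweepL. Qed.

Lemma size_cells m : size (cells m) = B.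
Proof. by rewrite size_map size_iota. Qed.

Lemma all_cells m : all is_cell (cells m).
Proof. by rewrite all_map; apply/allP. Qed.

Lemma hash_bits o : hash \notin bits o.
Proof. by apply/mapP => -[]. Qed.

Lemma hash_cells s : all is_cell s -> hash \notin s.
Proof. by move=> /allP h; apply/negP => /h. Qed.

Lemma runs_home_right m o : runs (act id MoveR) (home m o) 1 (Some true)
  (mk_tape [:: hash] (cells m ++ bits o ++ [:: inl None])).
Proof. exact: runs_act. Qed.

Lemma cell_markT m x i : x <= K ->
  mark x true (inr (Some (cell_at m i))) = inr (Some (cell_at (upd m x i) i)).
Proof.
move=> xK /=; congr (inr (Some (_, _))); apply/ffunP => k; rewrite !ffunE updE.
by rewrite -val_eqE /= inordK //; case: (val k =P x) => // _; rewrite eqxx.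
Qed.

Lemma cell_markF m x v i : x <= K -> v != i ->
  mark x false (inr (Some (cell_at m i))) = inr (Some (cell_at (upd m x v) i)).
Proof.
move=> xK vi /=; congr (inr (Some (_, _))); apply/ffunP => k; rewrite !ffunE updE.
by rewrite -val_eqE /= inordK //; case: (val k =P x) => // _; rewrite (negbTE vi).
Qed.

Lemma cell_upd m x v i : m x != i -> v != i -> cell_at (upd m x v) i = cell_at m i.
Proof.
move=> xi vi; congr (_, _); apply/ffunP => k; rewrite !ffunE updE.
by case: (val k =P x) => // ->; rewrite (negbTE vi) (negbTE xi).
Qed.

Lemma marked_at m x i : x <= K -> marked x (cell_at m i) = (m x == i).
Proof. by move=> xK; rewrite /marked ffunE inordK. Qed.

Lemma is_cell_tail o : ~~ is_cell (head (inl None) (bits o ++ [:: inl None])).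
Proof. by case: o. Qed.

Lemma hash_tail o : head (inl None) (bits o ++ [:: inl None]) != hash.
Proof. by case: o. Qed.

Lemma tail_neq0 o : bits o ++ [:: inl None] != [::].
Proof. by case: o. Qed.

Lemma runs_clear x m o k : x <= K -> 2 * B + 8 <= k ->
  runs (clear x) (home m o) k (Some true) (home (upd m x 0) o).
Proof.
move=> xK hk; apply: (runsW hk) => {k hk}.
apply: (runs_seqp (runs_home_right m o) _ (k2 := 2 * B + 7)); last by lia.
set c0 : sym := inr (Some (cell_at m 0)).
set cs : seq sym := [seq inr (Some (cell_at m i)) | i <- iota 1 (size w).+1].
have cE : cells m = c0 :: cs by [].
have scs : size cs = (size w).+1 by rewrite size_map size_iota.
apply: (@runs_seqp _ _ 1 (2 * B + 6) _ _ (Some true)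
  (mk_tape (mark x true c0 :: [:: hash]) (cs ++ bits o ++ [:: inl None]))); last by lia.
  by apply: runs_act.
apply: (runs_seqp (@runs_sweepR _ (mark x false) cs _ _ _ _) _ (k2 := B + 4)); last by lia.
- by rewrite all_map; apply/allP.
- exact: is_cell_tail.
have -> : rev (map (mark x false) cs) ++ [:: mark x true c0; hash] =
          rev (cells (upd m x 0)) ++ [:: hash].
  rewrite -cat_rcons -rev_cons; congr (rev (_ :: _) ++ _); first exact: cell_markT.
  rewrite -map_comp; apply/eq_in_map => i; rewrite mem_iota => hi.
  by apply: cell_markF => //; lia.
apply: runs_sweepLn; rewrite ?size_cells ?hash_tail ?tail_neq0 //.
- exact/hash_cells/all_cells.
- by lia.
Qed.

Lemma runs_incr x m o k : x <= K -> 2 * B + 8 <= k ->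
  runs (incr x) (home m o) k (Some true) (home (upd m x (m x).+1) o).
Proof.
move=> xK hk; apply: (runsW hk) => {k hk}.
apply: (runs_seqp (runs_home_right m o) _ (k2 := 2 * B + 7)); last by lia.
set v := m x.
set T := bits o ++ [:: inl None].
set CL := fun m i => inr (Some (cell_at m i)) : sym.
pose A := [seq CL m i | i <- iota 0 (minn v B)].
have hA : all (predC (stop_at x)) A.
  rewrite all_map; apply/allP => i; rewrite mem_iota /= marked_at // => hi.
  by rewrite -/v; lia.
have AC : all is_cell A by rewrite all_map; apply/allP.
have sA : size A = minn v B by rewrite size_map size_iota.
have AE : A = [seq CL (upd m x v.+1) i | i <- iota 0 (minn v B)].
  apply/eq_in_map => i; rewrite mem_iota /CL => hi.
  by rewrite cell_upd // -/v; lia.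
(* With the mark absent, the sweep crosses all cells and stops at the first non-cell, where both
   writing actions do nothing. *)
have [vB|Bv] := ltnP v B; last first.
  have mB : minn v B = B by lia.
  have cE : cells m = A by rewrite /A mB.
  have cE' : cells (upd m x v.+1) = A by rewrite AE mB.
  have hT : stop_at x (head (inl None) T) by rewrite /T; case: (o).
  rewrite cE.
  apply: (runs_seqp (@runs_sweepR _ id A T _ hA hT) _ (k2 := B + 5)); last by lia.
  rewrite map_id.
  have mT b : mark x b (head (inl None) T) = head (inl None) T by rewrite /T; case: (o).
  apply: (@runs_seqp _ _ 1 (B + 4) _ _ (Some true) (mk_tape (rev A ++ [:: hash]) T)); last by lia.
    by apply: runs_act => //=; rewrite mT (negbTE (is_cell_tail o)).
  apply: (@runs_seqp _ _ 1 (B + 3) _ _ (Some true) (mk_tape (rev A ++ [:: hash]) T)); last by lia.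
    by apply: runs_act => //=; rewrite mT.
  rewrite /home cE'; apply: runs_sweepLn; rewrite ?hash_tail ?tail_neq0 //.
  - exact/hash_cells.
  - by rewrite sA; lia.
have mB : minn v B = v by lia.
pose D := [seq CL m i | i <- iota v.+1 (B - v.+1)].
have cE : cells m = A ++ CL m v :: D.
  rewrite /cells -/(iota 0 B) (_ : iota 0 B = iota 0 v ++ v :: iota v.+1 (B - v.+1)).
    by rewrite map_cat /A mB.
  by rewrite -[v :: _]/(iota v (B - v.+1).+1) -{3}(add0n v) -iotaD; congr iota; lia.
pose D' := [seq CL (upd m x v.+1) i | i <- iota v.+1 (B - v.+1)].
have cE' : cells (upd m x v.+1) = A ++ CL (upd m x v.+1) v :: D'.
  rewrite /cells -/(iota 0 B) (_ : iota 0 B = iota 0 v ++ v :: iota v.+1 (B - v.+1)).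
    by rewrite map_cat AE mB.
  by rewrite -[v :: _]/(iota v (B - v.+1).+1) -{3}(add0n v) -iotaD; congr iota; lia.
rewrite cE -catA cat_cons.
have hS : stop_at x (head (inl None) (CL m v :: D ++ T)) by rewrite /= marked_at.
apply: (runs_seqp (@runs_sweepR _ id A _ _ hA hS) _ (k2 := v + 6)); last by rewrite sA; lia.
rewrite map_id.
have mE : mark x false (CL m v) = CL (upd m x v.+1) v by apply: cell_markF => //; lia.
apply: (@runs_seqp _ _ 1 (v + 5) _ _ (Some true)
    (mk_tape (rev (rcons A (CL (upd m x v.+1) v)) ++ [:: hash]) (D ++ T))); last by lia.
  by apply: runs_act => //; rewrite /move_head -mE rev_rcons.
(* If [v] is the last cell, [D] is empty and the new mark would land on the output part, which
   [mark] leaves alone. *)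
have DE : mark x true (head (inl None) (D ++ T)) :: behead (D ++ T) = D' ++ T.
  rewrite /D /D'; case: (B - v.+1) => [|n] /=.
    by rewrite /T; case: (o).
  rewrite -[inr _]/(mark x true (CL m v.+1)) cell_markT //; congr cons; congr cat.
  apply/eq_in_map => i; rewrite mem_iota /CL => hi.
  by rewrite cell_upd // -/v; lia.
apply: (@runs_seqp _ _ 1 (v + 4) _ _ (Some true)
    (mk_tape (rev (rcons A (CL (upd m x v.+1) v)) ++ [:: hash]) (D' ++ T))); last by lia.
  by apply: runs_act => //=; rewrite -DE.
rewrite /home cE' -/T -catA cat_cons -[A ++ CL (upd _ _ _) _ :: _]cat_rcons; apply: runs_sweepLn.
- by apply: hash_cells; rewrite all_rcons AC.
- rewrite /D'; case: (B - v.+1) => [|n] //; exact: hash_tail.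
- by rewrite -DE.
- by rewrite size_rcons sA; lia.
Qed.

(** The stopping place depends on [f], so the split of the tape is existential and records just what
    the return sweep needs. *)
Lemma runs_scan_loop f m s T l :
  ~~ is_cell (head (inl None) T) -> head (inl None) T != hash -> T != [::] ->
  exists xs ys,
  [/\ xs ++ ys = [seq inr (Some (cell_at m i)) | i <- s] ++ T,
      head (inl None) ys != hash /\ ys != [::], all is_cell xs, size xs <= size s &
  runs (scan_loop f) (mk_tape l ([seq inr (Some (cell_at m i)) | i <- s] ++ T)) (size xs).+1
    (Some (foldr (fun i r => odflt r (f (cell_at m i))) false s))
    (mk_tape (rev xs ++ l) ys)].
Proof.
move=> cT hT nT; elim: s l => [|i s IH] l /=.
  exists [::], T; split => //=; apply: runs_loop_exit.
  apply: (@runs_act _ _ _ _ _ (head (inl None) T) Stay) => //=.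
  by case: (head _ _) cT => [|[]] //=.
case E : (f (cell_at m i)) => [b|] /=.
  exists [::], (inr (Some (cell_at m i)) :: [seq inr (Some (cell_at m i)) | i <- s] ++ T).
  by split => //=; apply: runs_loop_exit; apply: runs_act; rewrite /= ?E.
have [xs [ys [h1 h2 h3 h4 h5]]] := IH (inr (Some (cell_at m i)) :: l).
exists (inr (Some (cell_at m i)) :: xs), ys; split; rewrite /= ?h1 //.
apply: (@runs_loop_next _ _ 1 (size xs).+1).
- by apply: runs_act; rewrite /= ?E.
- by rewrite rev_cons cat_rcons.
- by [].
Qed.

Lemma runs_scan f m o k : 2 * B + 8 <= k ->
  runs (scan f) (home m o) k
    (Some (foldr (fun i r => odflt r (f (cell_at m i))) false (iota 0 B)))
    (home m o).
Proof.
move=> hk; apply: (runsW hk) => {k hk}.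
apply: (runs_seqp (runs_home_right m o) _ (k2 := 2 * B + 7)); last by lia.
have [xs [ys [h1 [h2 h3] h4 h5 h6]]] := @runs_scan_loop f m (iota 0 B) _ [:: hash]
  (is_cell_tail o) (hash_tail o) (tail_neq0 o).
rewrite /home /cells -h1 in h6 *.
apply: (runs_cond h6 (k2 := (size xs).+2)); last by move: h5; rewrite size_iota; lia.
by case: (foldr _ _ _); apply: runs_sweepLn => //; apply: hash_cells.
Qed.

Lemma runs_write b m o k : 2 * (B + size o) + 8 <= k ->
  runs (write b) (home m o) k (Some false) (home m (rcons o b)).
Proof.
move=> hk; apply: (runsW hk) => {k hk}.
apply: (runs_seqp (runs_home_right m o) _ (k2 := 2 * (B + size o) + 7)); last by lia.
have hA : all (predC (pred1 (inl None))) (cells m ++ bits o).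
  rewrite all_cat; apply/andP; split; last by rewrite all_map; apply/allP.
  by rewrite all_map; apply/allP.
have hS : pred1 (inl None) (head (inl None) [:: inl None : sym]) by [].
have hs : size (cells m ++ bits o) = B + size o by rewrite size_cat size_cells size_map.
rewrite catA; apply: (runs_seqp (@runs_sweepR _ id _ _ _ hA hS) _ (k2 := B + size o + 5)); last by lia.
rewrite map_id.
apply: (@runs_seqp _ _ 1 (B + size o + 4) _ _ (Some true)
    (mk_tape (rev (cells m ++ bits (rcons o b)) ++ [:: hash]) [:: inl None])); last by lia.
  by rewrite /bits map_rcons -rcons_cat rev_rcons; apply: runs_act.
rewrite /home catA; apply: runs_sweepLn => //.
  by rewrite mem_cat negb_or hash_bits hash_cells // all_cells.
by rewrite size_cat size_cells size_map size_rcons; lia.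
Qed.

Lemma foldr_first (F : nat -> option bool) v n b :
  v < n -> (forall i, i < v -> F i = None) -> F v = Some b ->
  foldr (fun i r => odflt r (F i)) false (iota 0 n) = b.
Proof.
move=> vn h1 h2; have -> : n = v + (n - v).-1.+1 by lia.
rewrite iotaD foldr_cat /= add0n h2 /=.
elim: v {vn h2} h1 => [|v IH] h1 //.
by rewrite -addn1 iotaD foldr_cat /= h1 //=; apply: IH => i hi; apply: h1; lia.
Qed.

Lemma foldr_none (F : nat -> option bool) n :
  (forall i, i < n -> F i = None) ->
  foldr (fun i r => odflt r (F i)) false (iota 0 n) = false.
Proof.
elim: n => [|n IH] h1 //.
by rewrite -addn1 iotaD foldr_cat /= h1 //=; apply: IH => i hi; apply: h1; lia.
Qed.

Lemma runs_test X R t m s o k : well_scoped K X R (Test t) -> (forall x, x \in X -> x <= K) ->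
  (forall x, x \in X -> m x = s x) -> 2 * B + 8 <= k ->
  runs (scan (scan_test t)) (home m o) k (Some (sem_test w t s)) (home m o).
Proof.
move=> /= wX XK ms hk; have := runs_scan (scan_test t) m o hk.
suff -> : foldr (fun i r => odflt r (scan_test t (cell_at m i))) false (iota 0 B) =
  sem_test w t s by [].
have mk x i : x \in X -> marked x (cell_at m i) = (m x == i).
  by move=> /XK; apply: marked_at.
have nth_w i : nth None (map Some w) i = if i < size w then Some (nth false w i) else None.
  by case: ltnP => hi; [rewrite (nth_map false) | rewrite nth_default ?size_map].
(* A variable replaces [B] because simplification would otherwise unroll the first two entries of
   [iota 0 B]. *)
have sem_n n : n = B -> foldr (fun i r => odflt r (scan_test t (cell_at m i))) false (iota 0 n) =
    sem_test w t s; last exact: sem_n.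
move=> nB; case: t wX => [x|x|x y|x y] /=; rewrite ?andbT -?nB.
- move=> hx; rewrite -ms //; case: (ltnP (m x) n) => h.
    apply: (foldr_first h) => [i hi|]; rewrite !mk //; first by case: eqP hi => // ->; rewrite ltnn.
    by rewrite eqxx nth_w; case: ltnP => h'; [case: nth | rewrite nth_default].
  by rewrite nth_default; [apply: foldr_none => i hi; rewrite mk // ifF //; lia | lia].
- move=> hx; rewrite -ms //; case: (ltnP (m x) n) => h.
    apply: (foldr_first h) => [i hi|]; rewrite !mk //; first by case: eqP hi => // ->; rewrite ltnn.
    by rewrite eqxx nth_w; case: ltnP.
  rewrite foldr_none; first by lia.
  by move=> i hi; rewrite mk // ifF //; lia.
- move=> /andP[hx hy]; rewrite -!ms //; case: (ltnP (m x) (m y)) => h.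
    case: (ltnP (m x) n) => h'.
      by apply: (foldr_first h') => [i hi|]; rewrite !mk //; [rewrite !ifF //; lia | rewrite ifF ?eqxx //; lia].
    by apply: foldr_none => i hi; rewrite !mk // !ifF //; lia.
  case: (ltnP (m y) n) => h'.
    by apply: (foldr_first h') => [i hi|]; rewrite !mk ?eqxx // !ifF //; lia.
  by apply: foldr_none => i hi; rewrite !mk // !ifF //; lia.
- move=> /andP[hx hy]; rewrite -!ms //; case: (ltnP (minn (m x) (m y)) n) => h; last first.
    rewrite foldr_none; first by lia.
    by move=> i hi; rewrite !mk // ifF //; lia.
  apply: (foldr_first h) => [i hi|]; rewrite !mk //; first by rewrite ifF //; lia.
  by rewrite ifT; [congr Some; lia | lia].
Qed.

Definition put (c : option nat) (o e : seq bool) := if c is None then o ++ e else o.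

Lemma put_cat c o e e' : put c (put c o e) e' = put c o (e ++ e').
Proof. by case: c => //=; rewrite catA. Qed.

Lemma put_nil c o : put c o [::] = o.
Proof. by case: c => //=; rewrite cats0. Qed.

Lemma size_put c o e : size o <= size (put c o e).
Proof. by case: c => //=; rewrite size_cat leq_addr. Qed.

End Correct.

(** Cost in units of [2 * Z + 8], the price of two sweeps over a tape with [Z] occupied cells. In a
    loop, the [4] pays for advancing the variable and testing for the end. *)
Fixpoint ops (B : nat) (P : prog) : nat :=
  match P with
  | Ret _ | Test _ => 1
  | Emit _ => 2
  | If P Q R => ops B P + ops B Q + ops B R
  | For x P => B * (ops B P + 4) + 1
  | Let x Q P => ops B Q + ops B P + 1
  end.

(** * Correctness and cost of compiled programs *)

Section Compile.
Variable w : seq bool.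
Notation B := (size w).+2.

(** Marks of [X] agree with the environment and marks of [R] survive; all others are scratch, which
    is why the final [m'] is only constrained on [R]. An enclosing counter lies in [R] but outside
    [X], because its mark moves while [P] runs and so has no fixed value to read. *)
Lemma compileP P c X R s m o Z : well_scoped K X R P ->
  (forall x, x \in R -> x <= K) -> {subset X <= R} ->
  (forall x, x \in X -> m x = s x) ->
  (forall x, c = Some x -> (x \in R) && (x \notin X)) ->
  B + size (put c o (sem w P s).2) <= Z ->
  exists2 m', runs (compile c P) (home w m o) ((2 * Z + 8) * ops B P)
                (Some (sem w P s).1) (home w m' (put c o (sem w P s).2)) &
    forall x, x \in R -> m' x = m x + (if c == Some x then size (sem w P s).2 else 0).
Proof.
elim: P c X R s m o Z => [b|t|b|P IHP Q IHQ Q' IHQ'|x P IHP|x Q IHQ P IHP] c X R s m o Z wP RK XR ms cX.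
- move=> /= hZ; exists m; last by move=> x _; case: ifP; rewrite addn0.
  by rewrite put_nil; apply: runs_act => //=; lia.
- move=> /= hZ; exists m; last by move=> x _; case: ifP; rewrite addn0.
  rewrite put_nil; apply: (runs_test _ wP) => //; first by move=> x /XR /RK.
  by move: hZ; rewrite put_nil; lia.
- case: c cX => [x|] /= cX hZ.
    have /andP[xR xX] := cX x erefl.
    exists (upd m x (m x).+1).
      apply: (runs_seqp (runs_incr m o (RK x xR) (leqnn _)) _ (k2 := 1)); last by lia.
      exact: runs_act.
    move=> y yR; rewrite updE; case: eqP => [->|yx]; first by rewrite eqxx addn1.
    by case: eqP => [[xy]|]; rewrite ?addn0 //; case: yx.
  exists m; last by move=> x _; rewrite addn0.
  by rewrite cats1; apply: runs_write; move: hZ; rewrite size_cat /=; lia.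
- move: wP => /= /and3P[wP wQ wQ'] hZ.
  case E : (sem w P s) hZ => [b e] /=.
  case E' : (if b then sem w Q s else sem w Q' s) => [b' e'] /= hZ.
  have hZ1 : B + size (put c o (sem w P s).2) <= Z.
    by have := size_put c (put c o e) e'; rewrite put_cat E /=; lia.
  have [m1 r1 m1P] := IHP c X R s m o Z wP RK XR ms cX hZ1.
  have m1s x : x \in X -> m1 x = s x.
    move=> xX; rewrite m1P ?XR // ms //; case: eqP => [cx|_]; rewrite ?addn0 //.
    by have := cX x cx; rewrite xX andbF.
  rewrite E /= in r1 m1P.
  have [m2 r2 m2P] : exists2 m', runs (if b then compile c Q else compile c Q')
         (home w m1 (put c o e)) ((2 * Z + 8) * (ops B Q + ops B Q'))
         (Some b') (home w m' (put c o (e ++ e'))) &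
      forall x, x \in R -> m' x = m1 x + (if c == Some x then size e' else 0).
    rewrite -put_cat in hZ *.
    case: b {E r1 hZ1} E' => E'.
      have := IHQ c X R s m1 (put c o e) Z wQ RK XR m1s cX.
      rewrite E' => /(_ hZ) [m2 r2 m2P]; exists m2 => //; apply: runsW r2.
      by rewrite leq_mul2l leq_addr orbT.
    have := IHQ' c X R s m1 (put c o e) Z wQ' RK XR m1s cX.
    rewrite E' => /(_ hZ) [m2 r2 m2P]; exists m2 => //; apply: runsW r2.
    by rewrite leq_mul2l leq_addl orbT.
  exists m2; first by apply: (runs_cond r1 (k2 := (2 * Z + 8) * (ops B Q + ops B Q')));
    [case: (b) r2 | rewrite -addnA !mulnDr].
  move=> x xR; rewrite m2P // m1P //=; case: ifP => _; last by rewrite !addn0.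
  by rewrite size_cat addnA.
- move: wP => /= /and3P[xR xK wP].
  set body := Cond (compile c P) _ _.
  pose f i := sem w P (upd s x i).
  suff loop n i m1 o1 : n.+1 + i = B -> m1 x = i ->
      (forall y, y \in X -> m1 y = s y) ->
      B + size (put c o1 (foreach f (iota i n.+1)).2) <= Z ->
      exists2 m', runs (Loop body) (home w m1 o1) ((2 * Z + 8) * (n.+1 * (ops B P + 4)))
                    (Some (foreach f (iota i n.+1)).1)
                    (home w m' (put c o1 (foreach f (iota i n.+1)).2)) &
        forall y, y \in R -> m' y = m1 y +
          (if c == Some y then size (foreach f (iota i n.+1)).2 else 0).
    have XE y : y \in X -> y != x.
      by move=> yX; apply: contraNneq xR => <-; apply: XR.
    move=> hZ; have [||y yX|//|m' r m'P] := loop (size w).+1 0 (upd m x 0) o.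
    - by rewrite addn0.
    - by rewrite updE eqxx.
    - by rewrite updE (negbTE (XE y yX)) ms.
    exists m'; last first.
      move=> y yR; rewrite m'P //; congr addn; rewrite updE; case: eqP => // yx.
      by rewrite -yx yR in xR.
    apply: (runs_seqp (runs_clear m o xK (leqnn _)) r).
    have : B <= Z by apply: leq_trans hZ; rewrite leq_addr.
    by move=> BZ; rewrite /= [leqRHS]mulnDr muln1 addnC leq_add2l; lia.
  move: n i m1 o1.
  have step i m1 o1 : i < B -> m1 x = i -> (forall y, y \in X -> m1 y = s y) ->
      B + size (put c o1 (f i).2) <= Z ->
      exists2 m2, runs body (home w m1 o1) ((2 * Z + 8) * (ops B P + 4))
          (if (f i).1 then Some true else if i.+1 < B then None else Some false)
          (home w m2 (put c o1 (f i).2)) &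
        (~~ (f i).1 -> m2 x = i.+1) /\
        forall y, y \in R -> m2 y = m1 y + (if c == Some y then size (f i).2 else 0).
    move=> iB m1x m1s hZ.
    have BZ : B + size o1 <= Z.
      by have := size_put c o1 (f i).2; lia.
    have [|||||m2 r2 m2P] := IHP c (x :: X) (x :: R) (upd s x i) m1 o1 Z wP.
    - by move=> y; rewrite inE => /orP[/eqP->|/RK].
    - by move=> y; rewrite !inE => /orP[->//|/XR ->]; rewrite orbT.
    - by move=> y; rewrite updE inE; case: eqP => [->//|_ /= /m1s].
    - move=> y /cX /andP[yR yX]; rewrite !inE yR orbT negb_or yX !andbT.
      by apply: contraNneq xR => <-.
    - exact: hZ.
    have cx : c != Some x by apply: contraNneq xR => /cX /andP[].
    have m2x : m2 x = i by rewrite m2P ?inE ?eqxx // (negbTE cx) addn0.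
    have m2R y : y \in R -> m2 y = m1 y + (if c == Some y then size (f i).2 else 0).
      by move=> yR; rewrite m2P // inE yR orbT.
    rewrite -/(f i) in r2; case: (f i) r2 m2R => [[] e] /= r2 m2R.
      exists m2 => //; apply: (runs_cond r2 (k2 := 1)); first exact: runs_act.
      by rewrite mulnDr leq_add2l; lia.
    exists (upd m2 x i.+1); last first.
      split=> [_|y yR]; first by rewrite updE eqxx.
      by rewrite updE -m2R //; case: eqP => // yx; rewrite -yx yR in xR.
    apply: (runs_cond r2 (k2 := (2 * Z + 8) * 4)); last by rewrite mulnDr.
    apply: (runs_seqp (k2 := (2 * Z + 8) * 3) (runs_incr m2 _ xK (leqnn _))); last by lia.
    (* [Eq x x] is not trivially true: it holds exactly when the mark of [x] is still on the tape,
       hence it detects the end of the loop. *)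
    have wt : well_scoped K [:: x] [:: x] (Test (Eq x x)) by rewrite /= !inE eqxx.
    rewrite m2x; set m3 := upd m2 x i.+1.
    have m3x : m3 x = i.+1 by rewrite /m3 updE eqxx.
    apply: (runs_cond (k2 := 1) (runs_test (m := m3) (s := m3) _ wt _ _ (leqnn _))) => //.
    + by move=> y; rewrite inE => /eqP->.
    + by rewrite /sem_test eqxx m3x; case: ltnP => _; apply: runs_act.
    + by lia.
  elim=> [|n IHn] i m1 o1 niB m1x m1s.
    have iB : i < B by lia.
    move=> /= hZ.
    have [|m2 r2 [_ m2R]] := step i m1 o1 iB m1x m1s.
      by apply: leq_trans hZ; case: (f i) => [[] e] /=; rewrite ?cats0.
    exists m2; last by move=> y yR; rewrite m2R //; case: (f i) => [[] e] /=; rewrite ?cats0.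
    have iB' : (i.+1 < B) = false by lia.
    rewrite iB' in r2.
    rewrite mul1n; apply: runs_loop_exit.
    by case: (f i) r2 => [[] e] /=; rewrite ?cats0.
  have iB : i < B by lia.
  rewrite -[iota i _]/(i :: iota i.+1 n.+1) foreach_cons.
  case E : (f i) => [b e].
  case E' : (foreach f (iota i.+1 n.+1)) => [b' e'] hZ.
  have [|m2 r2 [m2x m2R]] := step i m1 o1 iB m1x m1s.
    rewrite E; case: (b) hZ => //=.
    by have := size_put c (put c o1 e) e'; rewrite put_cat; lia.
  rewrite E /= in r2 m2x m2R.
  case: b E r2 m2x hZ => E r2 m2x hZ.
    exists m2 => //; apply: runsW (runs_loop_exit r2).
    by rewrite leq_mul2l mulSn leq_addr orbT.
  have iB' : i.+1 < B by lia.
  rewrite iB' in r2.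
  have [||y yX||m3 r3 m3R] := IHn i.+1 m2 (put c o1 e); rewrite ?E' ?put_cat //.
  - by lia.
  - exact: m2x.
  - rewrite m2R ?XR // m1s //; case: eqP => [cy|_]; rewrite ?addn0 //.
    by have := cX y cy; rewrite yX andbF.
  rewrite E' put_cat /= in r3 m3R.
  exists m3.
    by apply: (runs_loop_next r2 r3); rewrite -mulnDr -mulSn.
  by move=> y yR; rewrite m3R // m2R //=; case: ifP => _; rewrite ?size_cat ?addn0 // addnA.
- move: wP => /= /and4P[xR xK wQ wP] hZ.
  have xX : x \notin X by apply: contra xR => /XR.
  have XR' : {subset X <= x :: R} by move=> y /XR; rewrite inE orbC => ->.
  have RK' y : y \in x :: R -> y <= K by rewrite inE => /orP[/eqP->|/RK].
  have BZ : B + size o <= Z.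
    by have := size_put c o (sem w P (upd s x (size (sem w Q s).2))).2; lia.
  (* In mode [Some x] nothing is written: the mark of [x], cleared first, ends at the number of bits
     of [Q]. The outer counter stays where it is meanwhile. *)
  have [|||m1 r1 m1P] := IHQ (Some x) X (x :: R) s (upd m x 0) o Z wQ RK' XR'.
  - by move=> y yX; rewrite updE; case: eqP yX => [->|_ /ms]//; rewrite (negbTE xX).
  - by move=> _ [<-]; rewrite inE eqxx.
  - exact: BZ.
  have m1x : m1 x = size (sem w Q s).2.
    by rewrite m1P ?inE ?eqxx // updE eqxx.
  have m1E y : y \in R -> m1 y = m y.
    move=> yR; have yx : y != x by apply: contraNneq xR => <-.
    rewrite m1P ?inE ?yR ?orbT // updE (negbTE yx).
    by case: eqP => [[xy]|]; rewrite ?addn0 // xy eqxx in yx *.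
  have [||||m2 r2 m2P] := IHP c (x :: X) (x :: R) (upd s x (size (sem w Q s).2)) m1 o Z wP RK'.
  - by move=> y; rewrite !inE => /orP[->//|/XR ->]; rewrite orbT.
  - move=> y; rewrite updE inE; case: eqP => [->//|_ /= yX]; by rewrite m1E ?ms ?XR.
  - move=> y /cX /andP[yR yX]; rewrite !inE yR orbT negb_or yX !andbT.
    by apply: contraNneq xR => <-.
  - exact: hZ.
  exists m2.
    apply: (runs_seqp (runs_clear m o xK (leqnn _)) (runs_seqp r1 r2 (leqnn _))).
    by rewrite !mulnDr muln1; lia.
  by move=> y yR; rewrite m2P ?m1E // inE yR orbT.
Qed.
Definition to_cell (y : sym) : sym :=
  if y is inl b then inr (Some (b, [ffun=> false])) else y.

Definition setup : tprog :=
  seqp (act id MoveL)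
  (seqp (act (fun=> hash) MoveR)
  (seqp (sweepR (pred1 (inl None)) to_cell)
  (seqp (act to_cell MoveR)
  (seqp (act to_cell MoveR) (sweepL true))))).

(** [output] reads from the head to the right, so the head has to end on the first output bit. *)
Definition finish : tprog :=
  seqp (act id MoveR) (sweepR (predC is_cell) id).

Lemma runs_setup : runs setup (mk_tape [::] (bits w)) (2 * B + 8) (Some true)
  (home w (fun=> B) [::]).
Proof.
apply: (@runs_seqp _ _ 1 (2 * B + 7) _ _ (Some true)
  (mk_tape [::] (inl None :: head (inl None) (bits w) :: behead (bits w)))); last by lia.
  exact: runs_act.
apply: (@runs_seqp _ _ 1 (2 * B + 6) _ _ (Some true) (mk_tape [:: hash] (bits w ++ [::]))); last by lia.
  by rewrite cats0; apply: runs_act.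
have hA : all (predC (pred1 (inl None))) (bits w) by rewrite all_map; apply/allP.
apply: (runs_seqp (@runs_sweepR (pred1 (inl None)) to_cell (bits w) [::] _ hA isT) _ (k2 := B + 6));
  last by rewrite size_map; lia.
have hc i : i <= 1 -> to_cell (inl None) = inr (Some (cell_at w (fun=> B) (size w + i))).
  move=> hi; rewrite /cell_at nth_default ?size_map ?leq_addr //; congr (inr (Some (_, _))).
  by apply/ffunP => k; rewrite !ffunE; case: eqP => //; lia.
have cE : cells w (fun=> B) = map to_cell (bits w) ++ [:: to_cell (inl None); to_cell (inl None)].
  have iE : iota 0 B = iota 0 (size w) ++ [:: size w + 0; size w + 1].
    by rewrite -addn2 iotaD add0n /= addn0 addn1.
  rewrite /cells iE map_cat; congr (_ ++ _); last by rewrite {1}(hc 0) // (hc 1).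
  apply: (@eq_from_nth _ hash); rewrite !size_map ?size_iota // => i hi.
  rewrite (nth_map 0) ?size_iota // nth_iota // !(nth_map (inl None)) ?size_map //.
  rewrite (nth_map false) //=; congr (inr (Some (_, _))); first by rewrite (nth_map false).
  by apply/ffunP => k; rewrite !ffunE; case: eqP => //; lia.
apply: (@runs_seqp _ _ 1 (B + 5) _ _ (Some true)
  (mk_tape (rev (rcons (map to_cell (bits w)) (to_cell (inl None))) ++ [:: hash]) [::])); last by lia.
  by rewrite rev_rcons; apply: runs_act.
apply: (@runs_seqp _ _ 1 (B + 4) _ _ (Some true)
  (mk_tape (rev (cells w (fun=> B)) ++ [:: hash]) [::])); last by lia.
  have -> : cells w (fun=> B) = rcons (rcons (map to_cell (bits w)) (to_cell (inl None))) (to_cell (inl None)).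
    by rewrite cE -cat_rcons cats1.
  by rewrite [rev (rcons (rcons _ _) _)]rev_rcons; apply: runs_act.
by apply: (runsW _ (runs_sweepL _ _ _)); rewrite ?size_cells ?hash_cells ?all_cells //; lia.
Qed.

Lemma runs_finish m o : runs finish (home w m o) (B + 2) (Some true)
  (mk_tape (rev (cells w m) ++ [:: hash]) (bits o ++ [:: inl None])).
Proof.
apply: (runs_seqp (runs_home_right w m o) _ (k2 := B.+1)); last by lia.
have hA : all (predC (predC is_cell)) (cells w m).
  by rewrite (eq_all (a2 := is_cell)) ?all_cells // => x /=; rewrite negbK.
have := runs_sweepR id [:: hash] hA (is_cell_tail o); rewrite map_id => h.
by apply: runsW h; rewrite size_cells.
Qed.

End Compile.

Lemma size_foreach f l n : (forall i, size (f i).2 <= n) ->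
  size (foreach f l).2 <= size l * n.
Proof.
move=> fn; elim: l => [|i l IH] //; rewrite foreach_cons.
move: (fn i) IH; case: (f i) => [[] e] /=; first by rewrite mulSn; lia.
by case: foreach => [b' e'] /=; rewrite size_cat mulSn; lia.
Qed.

(** Writing a bit costs a sweep over the bits written before, so the time bound needs a bound on the
    output length; [ops] itself provides it. *)
Lemma size_sem w P s : size (sem w P s).2 <= ops (size w).+2 P.
Proof.
elim: P s => [b|t|b|P IHP Q IHQ R IHR|x P IHP|x Q _ P IHP] s //.
- move: (IHP s) (IHQ s) (IHR s); rewrite /=.
  case: (sem w P s) => [b e] /=; case: b.
    by case: (sem w Q s) => [b' e'] /=; rewrite size_cat; lia.
  by case: (sem w R s) => [b' e'] /=; rewrite size_cat; lia.
- rewrite [sem _ _ _]/(foreach _ (iota 0 (size w).+2)).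
  have := @size_foreach (fun i => sem w P (upd s x i)) (iota 0 (size w).+2) _ (fun i => IHP _).
  rewrite size_iota => /leq_trans; apply; rewrite [ops _ (For _ _)]/=.
  by rewrite mulnDr -addnA leq_addr.
- by move: (IHP (upd s x (size (sem w Q s).2))) => /=; lia.
Qed.

End Compiler.

(** * Running time *)

(** Restricting to [1 < n] lets a single power absorb constants and sums; it is applied to the
    number of cells, which is at least 2. *)
Definition polybounded (f : nat -> nat) := exists k, forall n, 1 < n -> f n <= n ^ k.

Lemma polybounded_const c : polybounded (fun=> c).
Proof.
exists c => n n1; apply: ltnW; apply: leq_trans (ltn_expl c (isT : 1 < 2)) _.
by case: (c) => // e; rewrite leq_exp2r.
Qed.

Lemma polybounded_id : polybounded id.
Proof. by exists 1 => n _; rewrite expn1. Qed.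

Lemma polybounded_mul f g :
  polybounded f -> polybounded g -> polybounded (fun n => f n * g n).
Proof.
move=> [k hk] [l hl]; exists (k + l) => n n1.
by rewrite expnD leq_mul ?hk ?hl.
Qed.

Lemma polybounded_add f g :
  polybounded f -> polybounded g -> polybounded (fun n => f n + g n).
Proof.
move=> [k hk] [l hl]; exists (maxn k l).+1 => n n1.
apply: (@leq_trans (n ^ maxn k l + n ^ maxn k l)).
  apply: leq_add; [apply: leq_trans (hk n n1) _ | apply: leq_trans (hl n n1) _].
    by rewrite leq_exp2l // leq_maxl.
  by rewrite leq_exp2l // leq_maxr.
by rewrite addnn -mul2n expnS leq_mul2r n1 orbT.
Qed.

Lemma polybounded_ops P : polybounded (ops ^~ P).
Proof.
by elim: P => /= *; do ?[exact: polybounded_const | exact: polybounded_id |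
  apply: polybounded_add | apply: polybounded_mul] => //.
Qed.

Lemma prog_poly_time K P : well_scoped K [::] [::] P ->
  poly_time_computable (fun w => (sem w P (fun=> 0)).2).
Proof.
move=> wP.
pose p := seqp (setup K) (seqp (compile K None P) (finish K)).
pose T n := (2 * n + 8) + ((2 * (n + ops n P) + 8) * ops n P + (n + 2)).
have [e he] : polybounded T.
  by rewrite /T; do ?[exact: polybounded_const | exact: polybounded_id |
    exact: polybounded_ops | apply: polybounded_add | apply: polybounded_mul].
(* The bound is [B ^ e] with [B = size w + 2]. For inputs of length at least 2, [B] is at most the
   square of the length, which gives the exponent [2 * e]; for lengths 0 and 1 the summand [3 ^ e]
   suffices. *)
exists (machine p), (2 * e + 3 ^ e) => w.
set o := (sem w P (fun=> 0)).2; set B := (size w).+2.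
have so : size o <= ops B P by apply: size_sem.
(* After [setup] all marks are absent, while the semantics starts from 0; since no variable is
   readable yet, the two need not agree. *)
have [//|//|//|//||m r _] := @compileP K w P None [::] [::] (fun=> 0) (fun=> B) [::] (B + ops B P) wP.
  by rewrite leq_add2l.
have {}r : runs p (mk_tape [::] (bits K w)) (T B) (Some true)
    (mk_tape (rev (cells K w m) ++ [:: hash K]) (bits K o ++ [:: inl None])).
  exact: (runs_seqp (runs_setup K w) (runs_seqp r (runs_finish K w m o) (leqnn _)) (leqnn _)).
exists (conf None (mk_tape (rev (cells K w m) ++ [:: hash K]) (bits K o ++ [:: inl None]))).
rewrite init_conf; split; last by apply: output_conf.
apply: runs_machine; apply: runsW r.
apply: leq_trans (he B isT) _; rewrite /B.
have mono m1 m2 : m1 <= m2 -> m1 ^ e <= m2 ^ e by case: (e) => // e'; rewrite leq_exp2r.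
case: (size w) => [|[|n]].
- by have := mono 2 3 isT; lia.
- by have := mono 3 3 isT; lia.
apply: leq_trans (mono _ (n.+2 ^ 2) _) _; first by rewrite -mulnn; nia.
by rewrite -expnM; apply: leq_trans (leq_addr _ _); rewrite leq_exp2l //; lia.
Qed.

(** * The two reductions as programs *)

Definition Not P := If P (Ret false) (Ret true).
Definition And P Q := If P Q (Ret false).
Definition Or P Q := If P (Ret true) Q.
Definition Xor P Q := If P (Not Q) Q.
Definition Seq P Q := If P Q Q.
Definition ForLt x n P := For x (If (Test (Lt x n)) P (Ret false)).
Definition Out P := If P (Emit true) (Emit false).

Definition loop (n : nat) (F : nat -> seq bool) := flatten [seq F i | i <- iota 0 n].

Lemma eq_loop n F G : (forall i, i < n -> F i = G i) -> loop n F = loop n G.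
Proof.
by move=> FG; congr flatten; apply/eq_in_map => i; rewrite mem_iota => /= /FG.
Qed.

Section ProgramSemantics.
Variable w : seq bool.
Notation B := (size w).+2.
Implicit Types (P Q : prog) (s : nat -> nat).

Lemma sem_for x P s :
  sem w (For x P) s = foreach (fun i => sem w P (upd s x i)) (iota 0 B).
Proof. by []. Qed.

Lemma sem_if P Q R s : sem w (If P Q R) s =
  let: (b, o) := sem w P s in
  let: (b', o') := if b then sem w Q s else sem w R s in (b', o ++ o').
Proof. by []. Qed.

Definition holds P s b := sem w P s = (b, [::]).
(** The value [false] matters: [true] would stop an enclosing [For]. *)
Definition emits P s o := sem w P s = (false, o).
Definition counts P s k := (sem w P s).1 = false /\ size (sem w P s).2 = k.

Lemma holds_not P s b : holds P s b -> holds (Not P) s (~~ b).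
Proof. by rewrite /holds /= => ->; case: b. Qed.

Lemma holds_and P Q s b c :
  holds P s b -> (b -> holds Q s c) -> holds (And P Q) s (b && c).
Proof. by rewrite /holds /= => ->; case: b => // ->. Qed.

Lemma holds_or P Q s b c :
  holds P s b -> holds Q s c -> holds (Or P Q) s (b || c).
Proof. by rewrite /holds /= => -> ->; case: b. Qed.

Lemma holds_xor P Q s b c : holds P s b -> holds Q s c -> holds (Xor P Q) s (b != c).
Proof. by rewrite /holds /= => -> ->; case: b; case: c. Qed.

Lemma holds_eq x y s : s x < B -> holds (Test (Eq x y)) s (s x == s y).
Proof. by rewrite /holds /= => ->; rewrite andbT. Qed.

Lemma holds_lt x y s : s x < B -> holds (Test (Lt x y)) s (s x < s y).
Proof. by rewrite /holds /= => ->; rewrite andbT. Qed.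

Lemma emits_out P s b : holds P s b -> emits (Out P) s [:: b].
Proof. by rewrite /holds /emits /= => ->; case: b. Qed.

Lemma emits_seq P Q s o o' : emits P s o -> emits Q s o' -> emits (Seq P Q) s (o ++ o').
Proof. by rewrite /emits /= => -> ->. Qed.

Lemma counts_seq P Q s k l : counts P s k -> counts Q s l -> counts (Seq P Q) s (k + l).
Proof.
move=> [] hP1 <- [] hQ1 <-; rewrite /counts /=.
by case: (sem w P s) hP1 => [b e] /= ->; case: (sem w Q s) hQ1 => [b' e'] /= ->; rewrite size_cat.
Qed.

Lemma emits_counts P s o : emits P s o -> counts P s (size o).
Proof. by rewrite /counts => ->. Qed.

Lemma foreach_cat f l l' : foreach f (l ++ l') =
  let: (b, o) := foreach f l in
  if b then (true, o) else let: (b', o') := foreach f l' in (b', o ++ o').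
Proof.
elim: l => [|i l IH] /=; first by case: foreach.
rewrite IH; case: (f i) => [[] o] //; case: (foreach f l) => [[] o1] //.
by case: (foreach f l') => b2 o2; rewrite catA.
Qed.

Lemma foreach_has f b l : (forall i, i \in l -> f i = (b i, [::])) ->
  foreach f l = (has b l, [::]).
Proof.
elim: l => [|i l IH] h //=; rewrite h ?inE ?eqxx // IH ?orbT //; first by case: (b i).
by move=> j jl; rewrite h // inE jl orbT.
Qed.

Lemma foreach_emits f F l : (forall i, i \in l -> f i = (false, F i)) ->
  foreach f l = (false, flatten [seq F i | i <- l]).
Proof.
elim: l => [|i l IH] h //=; rewrite h ?inE ?eqxx // IH //.
by move=> j jl; rewrite h // inE jl orbT.
Qed.

Lemma sem_forlt x n P s : x != n -> s n <= B ->
  sem w (ForLt x n P) s = foreach (fun i => sem w P (upd s x i)) (iota 0 (s n)).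
Proof.
move=> xn nB; rewrite /ForLt sem_for.
have -> : iota 0 B = iota 0 (s n) ++ iota (0 + s n) (B - s n) by rewrite -iotaD subnKC.
rewrite foreach_cat.
have -> : foreach (fun i => sem w (If (Test (Lt x n)) P (Ret false)) (upd s x i))
   (iota (0 + s n) (B - s n)) = (false, [::]).
  rewrite (@foreach_has _ pred0) => [|i]; first by rewrite has_pred0.
  rewrite mem_iota add0n => /andP[hi _] /=.
  by rewrite !updE eqxx [n == x]eq_sym (negbTE xn) ltnNge hi.
have eq_f l f g : (forall i, i \in l -> f i = g i) -> foreach f l = foreach g l.
  elim: l => [|i l IH] //= h; rewrite h ?inE ?eqxx // IH // => j jl.
  by rewrite h // inE jl orbT.
rewrite (@eq_f _ _ (fun i => sem w P (upd s x i))).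
  by case: foreach => [[] o] //; rewrite cats0.
move=> i; rewrite mem_iota /= add0n => hi; rewrite !updE eqxx [n == x]eq_sym (negbTE xn) hi.
by rewrite (leq_trans hi nB) /=; case: sem.
Qed.

Lemma holds_forlt x n P s b : x != n -> s n <= B ->
  (forall i, i < s n -> holds P (upd s x i) (b i)) ->
  holds (ForLt x n P) s (has b (iota 0 (s n))).
Proof.
move=> xn nB h; rewrite /holds sem_forlt //; apply: foreach_has => i.
by rewrite mem_iota => /= /h.
Qed.

Lemma emits_forlt x n P s F : x != n -> s n <= B ->
  (forall i, i < s n -> emits P (upd s x i) (F i)) ->
  emits (ForLt x n P) s (loop (s n) F).
Proof.
move=> xn nB h; rewrite /emits sem_forlt //; apply: foreach_emits => i.
by rewrite mem_iota => /= /h.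
Qed.

Lemma counts_forlt x n P s k : x != n -> s n <= B ->
  (forall i, i < s n -> counts P (upd s x i) k) ->
  counts (ForLt x n P) s (s n * k).
Proof.
move=> xn nB h; rewrite /counts sem_forlt //.
rewrite (@foreach_emits _ (fun i => (sem w P (upd s x i)).2)) => [|i]; last first.
  by rewrite mem_iota => /= /h[]; case: sem => b e /= ->.
split=> //=; rewrite size_flatten /shape -map_comp.
have : all (fun i => size (sem w P (upd s x i)).2 == k) (iota 0 (s n)).
  by apply/allP => i; rewrite mem_iota => /= /h[_ ->].
rewrite -[in RHS](size_iota 0 (s n)); elim: (iota _ _) => [|i l IH] //= /andP[/eqP-> /IH ->].
by rewrite mulSn.
Qed.

Lemma sem_let x Q P s k : counts Q s k -> sem w (Let x Q P) s = sem w P (upd s x k).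
Proof. by case=> _ /= ->. Qed.

Fixpoint Tick (k : nat) := if k is k'.+1 then Seq (Emit true) (Tick k') else Ret false.

Lemma counts_tick k s : counts (Tick k) s k.
Proof. by elim: k => [|k IH] //=; apply: (@counts_seq _ _ _ 1 k). Qed.

(** Variables from 40 on are reserved for the internal loops of the arithmetic, whence the
    hypotheses [x < 40]. *)
Definition Add x := ForLt 40 x (Emit true).

Lemma counts_add x s : x < 40 -> s x <= B -> counts (Add x) s (s x).
Proof.
move=> x40 xB; have -> : s x = s x * 1 by rewrite muln1.
by apply: counts_forlt; rewrite // neq_ltn x40 orbT.
Qed.

(** Random access into a matrix: the position of bit [d] of entry [(i, j)], in row-major order with
    [r] bits per entry from offset [b], is counted in unary and then read. *)
Definition Entry r b d i j := Let 41
  (Seq (Add b) (Seq (ForLt 42 i (ForLt 43 0 (Tick r))) (Seq (ForLt 42 j (Tick r)) (Tick d))))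
  (Test (Bit 41)).

Lemma holds_entry r b d i j s : b < 40 -> i < 40 -> j < 40 ->
  s 0 <= B -> s b <= B -> s i <= B -> s j <= B ->
  holds (Entry r b d i j) s (nth false w (s b + (s i * s 0 + s j) * r + d)).
Proof.
move=> b40 i40 j40 nB bB iB jB; rewrite /holds.
rewrite (@sem_let _ _ _ _ (s b + (s i * (s 0 * r) + (s j * r + d)))); last first.
  apply: counts_seq; first exact: counts_add.
  apply: counts_seq.
    apply: counts_forlt => //; first by lia.
    by move=> v vi; apply: (@counts_forlt 43 0 _ (upd s 42 v)) => // *; apply: counts_tick.
  apply: counts_seq; last exact: counts_tick.
  by apply: counts_forlt => // [|*]; [lia | apply: counts_tick].
by rewrite /= updE eqxx; congr (nth _ _ _, _); lia.
Qed.

End ProgramSemantics.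

Lemma count_lt k n : k <= n -> count (fun i => i < k) (iota 0 n) = k.
Proof.
move=> kn; rewrite -(subnKC kn) iotaD count_cat.
rewrite (eq_in_count (a2 := predT)) => [|i]; last by rewrite mem_iota => /= ->.
rewrite count_predT size_iota (eq_in_count (a2 := pred0)) ?count_pred0 ?addn0 // => i.
by rewrite mem_iota /= => /andP[+ _]; rewrite ltnNge => ->.
Qed.

(** * Parsing the input word *)

Definition block_size (r n : nat) := n * n * r + n + 1.

(* Both graphs are required to have the same number of vertices: otherwise they are
   not isomorphic anyway. *)
Definition formatted (r : nat) (w : seq bool) :=
  let n := index false w in let h := block_size r n in
  [&& size w == h + h, ~~ has (fun t => ~~ nth false w (h + t)) (iota 0 n) &
      ~~ nth false w (h + n)].

(** A position is counted when the search finds no zero at or before it. Positions past the input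
    read as zero, so the count stops there at the latest. *)
Definition Lead := For 10 (If
  (For 11 (And (Not (Test (Lt 10 11))) (Not (Test (Bit 11)))))
  (Ret false) (Emit true)).

Definition Block r := Seq (ForLt 10 0 (ForLt 11 0 (Tick r))) (Seq (Add 0) (Tick 1)).

Definition Len := For 10 (If (Test (In 10)) (Emit true) (Ret false)).

Definition Format := And (Test (Eq 3 2)) (And
  (Not (ForLt 10 0 (Let 11 (Seq (Add 1) (Add 10)) (Not (Test (Bit 11))))))
  (Let 11 (Seq (Add 1) (Add 0)) (Not (Test (Bit 11))))).

(* Variable 0 holds the number of vertices, 1 the length of the code of one graph,
   and 4 and 5 the offsets of the two adjacency matrices. *)
Definition Main r X :=
  Let 0 Lead (Let 1 (Block r) (Let 2 (Seq (Block r) (Block r)) (Let 3 Len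
    (If Format
      (Let 4 (Seq (Add 0) (Tick 1)) (Let 5 (Seq (Add 1) (Add 4)) X))
      (Ret false))))).

Section MainSemantics.
Variable w : seq bool.
Notation B := (size w).+2.

Lemma counts_for x P s F :
  (forall i, i < B -> counts w P (upd s x i) (nat_of_bool (F i))) ->
  counts w (For x P) s (count F (iota 0 B)).
Proof.
move=> h; rewrite /counts sem_for.
have {h} : forall i, i \in iota 0 B -> counts w P (upd s x i) (F i).
  by move=> i; rewrite mem_iota => /h.
move: (iota 0 B) => l h.
rewrite (@foreach_emits _ (fun i => (sem w P (upd s x i)).2)) => [|i /h[]]; last first.
  by case: sem => b e /= ->.
split=> //=; elim: l h => [|i l IH] h //=.
by rewrite size_cat IH => [|j jl]; [case: (h i (mem_head _ _)) => _ -> | apply: h; rewrite inE jl orbT].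
Qed.

Lemma counts_lead s : counts w Lead s (index false w).
Proof.
rewrite -[X in counts _ _ _ X](@count_lt _ B); last exact/leqW/leqW/index_size.
apply: counts_for => p pB; rewrite /counts.
set P := For 11 _.
have -> : sem w (If P (Ret false) (Emit true)) (upd s 10 p) =
    if p < index false w then (false, [:: true]) else (false, [::]).
  have : sem w P (upd s 10 p) = (has (fun q => ~~ (p < q) && ~~ nth false w q) (iota 0 B), [::]).
    by rewrite sem_for; apply: foreach_has => q hq; rewrite /= pB andbT;
      case: (p < q) => //=; case: nth.
  rewrite sem_if => ->; case: ltnP => h.
    rewrite (_ : has _ _ = false) //; apply/negbTE/hasPn => q hq; rewrite negb_and !negbK.
    case: ltnP => //= qp; have := before_find false (leq_ltn_trans qp h).
    by rewrite /= eqbF_neg => /negbFE.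
  (* If [w] contains no zero, the witness is [size w], the first padding position. *)
  rewrite (_ : has _ _ = true) //; apply/hasP; exists (index false w).
    by rewrite mem_iota /=; have := index_size false w; lia.
  rewrite -leqNgt h /=; case: (boolP (false \in w)) => [/(nth_index false) ->//|].
  by move=> /memNindex ->; rewrite nth_default.
by case: ifP.
Qed.

Lemma counts_block r s : s 0 <= B -> counts w (Block r) s (block_size r (s 0)).
Proof.
move=> nB; rewrite /block_size -addnA -mulnA; apply: counts_seq.
  by apply: counts_forlt => // i _; apply: (@counts_forlt w 11 0 _ (upd s 10 i)) => // *;
    apply: counts_tick.
by apply: counts_seq; [apply: counts_add | apply: counts_tick].
Qed.

Lemma counts_len s : counts w Len s (size w).
Proof.
rewrite -[X in counts _ _ _ X](@count_lt _ B); last by lia.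
by apply: counts_for => p pB; rewrite /counts /=; case: ifP.
Qed.

Lemma counts_add2 x y s : x < 40 -> y < 40 -> s x <= B -> s y <= B ->
  counts w (Seq (Add x) (Add y)) s (s x + s y).
Proof. by move=> *; apply: counts_seq; apply: counts_add. Qed.

Lemma holds_let x Q P s k b :
  counts w Q s k -> holds w P (upd s x k) b -> holds w (Let x Q P) s b.
Proof. by rewrite /holds => h1 h2; rewrite (sem_let _ _ h1). Qed.

Lemma holds_format r s n : n = index false w -> s 0 = n -> s 1 = block_size r n ->
  s 2 = block_size r n + block_size r n -> s 3 = size w ->
  holds w Format s (formatted r w).
Proof.
move=> nE s0 s1 s2 s3.
have nL : n <= size w by rewrite nE index_size.
rewrite /formatted -nE -s3 -s1.
have e : (s 3 == s 1 + s 1) = (s 3 == s 2) by rewrite s2 s1.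
(* [And] is lazy: the other checks run only when the length is right, and then the block length in
   variable 1 fits on the tape, as [Add] requires. *)
rewrite e; apply: holds_and => [|/eqP s23]; first by apply: holds_eq; rewrite s3.
have hB : s 1 <= size w by rewrite -s3 s23 s2 s1 leq_addr.
apply: holds_and => [|_].
  apply: holds_not; rewrite -s0; apply: holds_forlt => // [|i ni]; first by lia.
  apply: (holds_let (counts_add2 _ _ _ _)) => //; try by rewrite /upd /=; lia.
  exact: holds_not.
apply: (holds_let (counts_add2 _ _ _ _)) => //; try by lia.
by rewrite s0; apply: holds_not.
Qed.

Lemma sem_main r X : exists s, let n := index false w in
  [/\ s 0 = n, s 1 = block_size r n, s 4 = n + 1, s 5 = block_size r n + (n + 1) &
  (sem w (Main r X) (fun=> 0)).2 = if formatted r w then (sem w X s).2 else [::]].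
Proof.
set n := index false w; set h := block_size r n.
have nL : n <= size w by rewrite index_size.
pose s1 := upd (fun=> 0) 0 n.
pose s2 := upd s1 1 h.
pose s3 := upd s2 2 (h + h).
pose s4 := upd s3 3 (size w).
pose s5 := upd s4 4 (n + 1).
exists (upd s5 5 (h + (n + 1))); split=> //.
rewrite /Main (sem_let _ _ (counts_lead _)) -/n -/s1.
have c1 : counts w (Block r) s1 h by apply: (@counts_block r s1); rewrite /s1 /upd /=; lia.
rewrite (sem_let _ _ c1) -/s2.
have c2 : counts w (Block r) s2 h by apply: (@counts_block r s2); rewrite /s2 /s1 /upd /=; lia.
rewrite (sem_let _ _ (counts_seq c2 c2)) -/s3 (sem_let _ _ (counts_len _)) -/s4.
have := @holds_format r s4 n erefl erefl erefl erefl erefl.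
rewrite /holds sem_if => ->.
case: ifP => // /and3P[/eqP hw _ _].
have c4 : counts w (Seq (Add 0) (Tick 1)) s4 (n + 1).
  by apply: counts_seq; [apply: (@counts_add w 0 s4) => //; rewrite /s4 /s3 /s2 /s1 /upd /=; lia | apply: counts_tick].
rewrite (sem_let _ _ c4) -/s5.
have hL : h <= size w by rewrite hw leq_addr.
have c5 : counts w (Seq (Add 1) (Add 4)) s5 (h + (n + 1)).
  by apply: (@counts_add2 1 4 s5) => //; rewrite /s5 /s4 /s3 /s2 /s1 /upd /=; lia.
by rewrite (sem_let _ _ c5); case: sem.
Qed.

End MainSemantics.

Definition entry (r n base d : nat) (w : seq bool) (i j : nat) : bool :=
  nth false w (base + (i * n + j) * r + d).

Definition bad_graph n (A : nat -> nat -> bool) :=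
  has (fun i => has (fun j => (A i j != A j i) || ((i == j) && A i j)) (iota 0 n))
    (iota 0 n).

Definition lit n (c : nat -> nat -> bool) i := has (fun j => c i j) (iota 0 n).

(** The negation of the conditions of [lcn_graph], in the shape of a search for a violation because
    [For] is a search. The first disjunct excludes the bit pair 11, which codes no color. *)
Definition bad_cgraph n (c1 c2 : nat -> nat -> bool) :=
  has (fun i => has (fun j =>
     [|| c1 i j && c2 i j, c1 i j != c1 j i, c2 i j != c2 j i,
         (i == j) && (c1 i j || c2 i j), c1 i j && ~~ (lit n c2 i != lit n c2 j)
       | c2 i j && has (fun k => c2 i k && ~~ (j == k)) (iota 0 n)])
    (iota 0 n)) (iota 0 n)
  || has (fun i => ~~ lit n c2 i && (3 < count (fun j => c1 i j) (iota 0 n))) (iota 0 n).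

(* Graph on the pairs [(i, k)] with [i < n] and [k < m], in lexicographic order. *)
Definition enc_pairs n m (F : nat -> nat -> nat -> nat -> seq bool) :=
  loop n (fun=> loop m (fun=> [:: true])) ++ false ::
  loop n (fun i => loop m (fun k => loop n (fun i' => loop m (fun k' => F i k i' k')))).

Definition inc n (A : nat -> nat -> bool) i k i' k' :=
  [&& k < n, k' == n, A i k & (i' == i) || (i' == k)].

(* The vertex [(i, k)] is, for [k < n], the clause {x_i, x_k} (empty if [ik] is not
   an edge), for [k = n] the literal x_i and for [k = n + 1] its negation. *)
Definition lcn_bits n A i k i' k' :=
  [:: inc n A i k i' k' || inc n A i' k' i k;
      (i == i') && ((k == n) && (k' == n + 1) || (k == n + 1) && (k' == n))].

(* Layer 0 carries the literal-clause edges and layer 1 the literal-literal edges;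
   [(i, 1)], [(i, 2)], [(i, 3)] are attached to [(i, 0)], so that the vertices with
   at least three neighbours are exactly those of layer 0. *)
Definition plain_bit (c1 c2 : nat -> nat -> bool) i k i' k' :=
  if k == 0 then if k' == 0 then c1 i i' else i == i'
  else if k' == 0 then i == i' else [&& k == 1, k' == 1 & c2 i i'].

Definition BadGraph b := ForLt 8 0 (ForLt 9 0
  (Or (Xor (Entry 1 b 0 8 9) (Entry 1 b 0 9 8))
      (And (Test (Eq 8 9)) (Entry 1 b 0 8 9)))).

Definition Lit b i := ForLt 10 0 (Entry 2 b 1 i 10).

Definition BadCgraph b := Or
  (ForLt 8 0 (ForLt 9 0
    (Or (And (Entry 2 b 0 8 9) (Entry 2 b 1 8 9))
    (Or (Xor (Entry 2 b 0 8 9) (Entry 2 b 0 9 8))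
    (Or (Xor (Entry 2 b 1 8 9) (Entry 2 b 1 9 8))
    (Or (And (Test (Eq 8 9)) (Or (Entry 2 b 0 8 9) (Entry 2 b 1 8 9)))
    (Or (And (Entry 2 b 0 8 9) (Not (Xor (Lit b 8) (Lit b 9))))
        (And (Entry 2 b 1 8 9)
             (ForLt 11 0 (And (Entry 2 b 1 8 11) (Not (Test (Eq 9 11)))))))))))))
  (ForLt 8 0 (And (Not (Lit b 8))
    (Let 14 (Tick 3) (Let 15 (ForLt 9 0 (If (Entry 2 b 0 8 9) (Emit true) (Ret false)))
      (Test (Lt 14 15)))))).

Definition OutPairs E := Seq (ForLt 8 0 (ForLt 9 7 (Emit true))) (Seq (Emit false)
  (ForLt 8 0 (ForLt 9 7 (ForLt 10 0 (ForLt 11 7 E))))).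

Definition Inc b i k i' k' := And (Test (Lt k 0)) (And (Test (Eq k' 0))
  (And (Entry 1 b 0 i k) (Or (Test (Eq i' i)) (Test (Eq i' k))))).

Definition LcnBits b := Seq (Out (Or (Inc b 8 9 10 11) (Inc b 10 11 8 9)))
  (Out (And (Test (Eq 8 10))
    (Or (And (Test (Eq 9 0)) (Test (Eq 11 4))) (And (Test (Eq 9 4)) (Test (Eq 11 0)))))).

Definition PlainBit b := Out (If (Test (Eq 9 12))
  (If (Test (Eq 11 12)) (Entry 2 b 0 8 10) (Test (Eq 8 10)))
  (If (Test (Eq 11 12)) (Test (Eq 8 10))
    (And (Test (Eq 9 13)) (And (Test (Eq 11 13)) (Entry 2 b 1 8 10))))).

Definition GraphToLcn := Main 1 (Let 7 (Seq (Add 0) (Tick 2))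
  (If (Or (BadGraph 4) (BadGraph 5)) (Ret false)
    (Seq (OutPairs (LcnBits 4)) (OutPairs (LcnBits 5))))).

Definition LcnToGraph := Main 2 (Let 7 (Tick 4) (Let 12 (Tick 0) (Let 13 (Tick 1)
  (If (Or (BadCgraph 4) (BadCgraph 5)) (Ret false)
    (Seq (OutPairs (PlainBit 4)) (OutPairs (PlainBit 5))))))).

Lemma well_scoped_GraphToLcn : well_scoped 43 [::] [::] GraphToLcn.
Proof. by vm_compute. Qed.

Lemma well_scoped_LcnToGraph : well_scoped 43 [::] [::] LcnToGraph.
Proof. by vm_compute. Qed.

(** * The programs compute the specified functions *)

Section Specs.
Variable w : seq bool.
Notation B := (size w).+2.

Lemma holds_if P Q R s b c d :
  holds w P s b -> holds w Q s c -> holds w R s d ->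
  holds w (If P Q R) s (if b then c else d).
Proof. by rewrite /holds /= => -> -> ->; case: b. Qed.

Lemma holds_entry' r b d i j s vb vi vj n : b < 40 -> i < 40 -> j < 40 ->
  s 0 = n -> s b = vb -> s i = vi -> s j = vj ->
  n <= size w -> vb <= size w -> vi <= size w -> vj <= size w ->
  holds w (Entry r b d i j) s (entry r n vb d w vi vj).
Proof. by move=> ? ? ? <- <- <- <- *; apply: holds_entry => //; lia. Qed.

Lemma holds_eq' x y s a b : s x = a -> s y = b -> a < B ->
  holds w (Test (Eq x y)) s (a == b).
Proof. by move=> <- <-; apply: holds_eq. Qed.

Lemma holds_lt' x y s a b : s x = a -> s y = b -> a < B ->
  holds w (Test (Lt x y)) s (a < b).
Proof. by move=> <- <-; apply: holds_lt. Qed.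

Lemma holds_forlt' x n P s v b : x != n -> s n = v -> v <= B ->
  (forall i, i < v -> holds w P (upd s x i) (b i)) ->
  holds w (ForLt x n P) s (has b (iota 0 v)).
Proof. by move=> xn <-; apply: holds_forlt. Qed.

Lemma emits_forlt' x n P s v F : x != n -> s n = v -> v <= B ->
  (forall i, i < v -> emits w P (upd s x i) (F i)) ->
  emits w (ForLt x n P) s (loop v F).
Proof. by move=> xn <-; apply: emits_forlt. Qed.

Lemma counts_forlt' x n P s v F : x != n -> s n = v -> v <= B ->
  (forall i, i < v -> counts w P (upd s x i) (nat_of_bool (F i))) ->
  counts w (ForLt x n P) s (count F (iota 0 v)).
Proof.
move=> xn <- nB h.
pose o i := (sem w P (upd s x i)).2.
have -> : count F (iota 0 (s n)) = size (loop (s n) o).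
  have : forall i, i \in iota 0 (s n) -> size (o i) = F i.
    by move=> i; rewrite mem_iota => /h[].
  rewrite /loop; elim: (iota _ _) => [|i l IH] //= ol.
  by rewrite size_cat ol ?mem_head // IH // => j jl; rewrite ol // inE jl orbT.
apply: emits_counts; apply: emits_forlt' => // i /h[].
by rewrite /emits /o; case: sem => b e /= ->.
Qed.

Section Base.
Variables (n b vb : nat) (s : nat -> nat).
Hypotheses (hb : b = 4 \/ b = 5) (s0 : s 0 = n) (sb : s b = vb).
Hypotheses (nL : n < size w) (vL : vb <= size w).

Let b40 : b < 40. Proof. by case: hb => ->. Qed.

Ltac ent := apply: holds_entry' => //; by [case: hb sb => -> | rewrite /upd /=; lia].
Ltac tst := first [apply: holds_eq' | apply: holds_lt'] => //; rewrite /upd /=; lia.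

Lemma holds_bad_graph : holds w (BadGraph b) s (bad_graph n (entry 1 n vb 0 w)).
Proof.
apply: holds_forlt' => // [|i hi]; first by lia.
apply: holds_forlt' => // [|j hj]; first by lia.
apply: holds_or; first by apply: holds_xor; ent.
by apply: holds_and => [|_]; [tst | ent].
Qed.

Lemma holds_bad_cgraph : holds w (BadCgraph b) s
  (bad_cgraph n (entry 2 n vb 0 w) (entry 2 n vb 1 w)).
Proof.
have hlit i s' : i < 9.+1 -> 0 < i -> i != b -> s' 0 = n -> s' b = vb -> s' i < n ->
    holds w (Lit b i) s' (lit n (entry 2 n vb 1 w) (s' i)).
  move=> i9 i0 ib s'0 s'b s'i; apply: holds_forlt' => // [|j hj]; first by lia.
  apply: holds_entry' => //; rewrite ?updE //; try lia.
  - by case: hb s'b => ->.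
  - by case: eqP => //; lia.
apply: holds_or.
  apply: holds_forlt' => // [|i hi]; first by lia.
  apply: holds_forlt' => // [|j hj]; first by lia.
  apply: holds_or; first by apply: holds_and => [|_]; ent.
  apply: holds_or; first by apply: holds_xor; ent.
  apply: holds_or; first by apply: holds_xor; ent.
  apply: holds_or.
    by apply: holds_and => [|_]; [tst | apply: holds_or; ent].
  apply: holds_or.
    apply: holds_and => [|_]; first by ent.
    apply: holds_not; apply: holds_xor.
      by apply: (@hlit 8) => //; case: hb sb => ->.
    by apply: (@hlit 9) => //; case: hb sb => ->.
  apply: holds_and => [|_]; first by ent.
  apply: holds_forlt' => // [|k hk]; first by lia.
  by apply: holds_and => [|_]; [ent | apply: holds_not; tst].
apply: holds_forlt' => // [|i hi]; first by lia.
apply: holds_and => [|_].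
  by apply: holds_not; apply: (@hlit 8) => //; case: hb sb => ->.
apply: (holds_let (counts_tick _ _ _)).
set s' := upd _ 14 3.
have c : counts w (ForLt 9 0 (If (Entry 2 b 0 8 9) (Emit true) (Ret false))) s'
    (count (fun j => entry 2 n vb 0 w i j) (iota 0 n)).
  apply: counts_forlt' => // [|j hj]; first by lia.
  have : holds w (Entry 2 b 0 8 9) (upd s' 9 j) (entry 2 n vb 0 w i j) by ent.
  by rewrite /holds /counts sem_if => ->; case: entry.
apply: (holds_let c); rewrite /holds /= /upd /=.
have := count_size (fun j => entry 2 n vb 0 w i j) (iota 0 n); rewrite size_iota => hc.
by congr (_, _); rewrite /s' /upd /=; lia.
Qed.

Variable m : nat.
Hypotheses (s7 : s 7 = m) (mB : m <= B).

Lemma emits_pairs E F :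
  (forall i k i' k', i < n -> k < m -> i' < n -> k' < m ->
    emits w E (upd (upd (upd (upd s 8 i) 9 k) 10 i') 11 k') (F i k i' k')) ->
  emits w (OutPairs E) s (enc_pairs n m F).
Proof.
move=> hE; apply: emits_seq.
  apply: emits_forlt' => // [|i _]; first by lia.
  exact: emits_forlt'.
apply: (@emits_seq _ _ _ _ [:: false]) => //.
apply: emits_forlt' => // [|i hi]; first by lia.
apply: emits_forlt' => // k hk.
apply: emits_forlt' => // [|i' hi']; first by lia.
apply: emits_forlt' => // k' hk'.
exact: hE.
Qed.

Lemma emits_lcn : s 4 = n + 1 -> m = n + 2 -> emits w (OutPairs (LcnBits b)) s
  (enc_pairs n m (lcn_bits n (entry 1 n vb 0 w))).
Proof.
move=> s4 mE; apply: emits_pairs => i k i' k' hi hk hi' hk'.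
apply: (@emits_seq _ _ _ _ [:: _] [:: _]); apply: emits_out.
  apply: holds_or.
    rewrite /inc; apply: holds_and => [|kn]; first by tst.
    apply: holds_and => [|_]; first by tst.
    by apply: holds_and => [|_]; [ent | apply: holds_or; tst].
  rewrite /inc; apply: holds_and => [|kn]; first by tst.
  apply: holds_and => [|_]; first by tst.
  by apply: holds_and => [|_]; [ent | apply: holds_or; tst].
apply: holds_and => [|_]; first by tst.
by apply: holds_or; apply: holds_and => [|_]; tst.
Qed.

Lemma emits_plain : s 12 = 0 -> s 13 = 1 -> emits w (OutPairs (PlainBit b)) s
  (enc_pairs n m (fun i k i' k' =>
    [:: plain_bit (entry 2 n vb 0 w) (entry 2 n vb 1 w) i k i' k'])).
Proof.
move=> s12 s13; apply: emits_pairs => i k i' k' hi hk hi' hk'.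
apply: emits_out; apply: holds_if; first by tst.
  by apply: holds_if; [tst | ent | tst].
apply: holds_if; [by tst.. |].
by apply: holds_and => [|_]; [tst | apply: holds_and => [|_]; [tst | ent]].
Qed.

End Base.

Let n := index false w.

Lemma formatted_bounds r : formatted r w -> [/\ n < size w,
  n + 1 <= size w, block_size r n + (n + 1) <= size w & 1 < size w].
Proof.
by move=> /and3P[/eqP hw _ _]; move: hw; rewrite -/n /block_size; split; lia.
Qed.

Lemma sem_GraphToLcn : (sem w GraphToLcn (fun=> 0)).2 =
  let A := entry 1 n (n + 1) 0 w in
  let A' := entry 1 n (block_size 1 n + (n + 1)) 0 w in
  if [&& formatted 1 w, ~~ bad_graph n A & ~~ bad_graph n A'] then
    enc_pairs n (n + 2) (lcn_bits n A) ++ enc_pairs n (n + 2) (lcn_bits n A')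
  else [::].
Proof.
have [s [s0 s1 s4 s5 ->]] := @sem_main w 1 (Let 7 (Seq (Add 0) (Tick 2))
  (If (Or (BadGraph 4) (BadGraph 5)) (Ret false)
    (Seq (OutPairs (LcnBits 4)) (OutPairs (LcnBits 5))))).
rewrite -/n in s0 s1 s4 s5; case: ifP => // /formatted_bounds [h1 h2 h3 h4].
have c : counts w (Seq (Add 0) (Tick 2)) s (n + 2).
  by apply: counts_seq; [rewrite -s0; apply: counts_add => //; lia | apply: counts_tick].
rewrite (sem_let _ _ c) sem_if; set s' := upd s 7 _.
have b4 := @holds_bad_graph n 4 _ s' (or_introl erefl) s0 s4 h1 h2.
have b5 := @holds_bad_graph n 5 _ s' (or_intror erefl) s0 s5 h1 h3.
have := holds_or b4 b5; rewrite /holds => ->; rewrite -negb_or; case: (_ || _) => //.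
have mB : n + 2 <= B by lia.
have o4 := @emits_lcn n 4 _ s' (or_introl erefl) s0 s4 h1 h2 (n + 2) erefl mB s4 erefl.
have o5 := @emits_lcn n 5 _ s' (or_intror erefl) s0 s5 h1 h3 (n + 2) erefl mB s4 erefl.
by rewrite (emits_seq o4 o5).
Qed.

Lemma sem_LcnToGraph : (sem w LcnToGraph (fun=> 0)).2 =
  let b := n + 1 in let b' := block_size 2 n + (n + 1) in
  let C d := entry 2 n b d w in
  let C' d := entry 2 n b' d w in
  if [&& formatted 2 w, ~~ bad_cgraph n (C 0) (C 1) & ~~ bad_cgraph n (C' 0) (C' 1)] then
    enc_pairs n 4 (fun i k i' k' => [:: plain_bit (C 0) (C 1) i k i' k']) ++
    enc_pairs n 4 (fun i k i' k' => [:: plain_bit (C' 0) (C' 1) i k i' k'])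
  else [::].
Proof.
have [s [s0 s1 s4 s5 ->]] := @sem_main w 2 (Let 7 (Tick 4) (Let 12 (Tick 0) (Let 13 (Tick 1)
  (If (Or (BadCgraph 4) (BadCgraph 5)) (Ret false)
    (Seq (OutPairs (PlainBit 4)) (OutPairs (PlainBit 5))))))).
rewrite -/n in s0 s1 s4 s5; case: ifP => // hf; have [h1 h2 h3 h4] := formatted_bounds hf.
do 3![rewrite (sem_let _ _ (counts_tick w _ _))]; rewrite sem_if; set s' := upd _ 13 _.
have b4 := @holds_bad_cgraph n 4 _ s' (or_introl erefl) s0 s4 h1 h2.
have b5 := @holds_bad_cgraph n 5 _ s' (or_intror erefl) s0 s5 h1 h3.
have := holds_or b4 b5; rewrite /holds => ->; rewrite -negb_or; case: (_ || _) => //.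
(* Tight for [n = 0]: the input then has length 2, and both padding cells are used to hold the value
   4. *)
have mB : 4 <= B.
  by move: hf; rewrite /formatted -/n /block_size => /and3P[/eqP -> _ _]; lia.
have o4 := @emits_plain n 4 _ s' (or_introl erefl) s0 s4 h1 h2 4 erefl mB erefl erefl.
have o5 := @emits_plain n 5 _ s' (or_intror erefl) s0 s5 h1 h3 4 erefl mB erefl erefl.
by rewrite (emits_seq o4 o5).
Qed.

End Specs.

(** * Encodings *)

Lemma loopS n F : loop n.+1 F = loop n F ++ F n.
Proof. by rewrite /loop -addn1 iotaD map_cat flatten_cat /= cats0. Qed.

Lemma size_loop n r F : (forall i, i < n -> size (F i) = r) -> size (loop n F) = n * r.
Proof.
elim: n => [|n IH] h //; rewrite loopS size_cat IH => [|i hi]; last by apply: h; lia.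
by rewrite h // mulSn addnC.
Qed.

Lemma nth_loop n r F i k : (forall i, i < n -> size (F i) = r) -> i < n -> k < r ->
  nth false (loop n F) (i * r + k) = nth false (F i) k.
Proof.
elim: n => [|n IH] // h; rewrite ltnS leq_eqVlt => /orP[/eqP->|hi] kr;
  have hs : size (loop n F) = n * r by apply: size_loop => j hj; apply: h; lia.
  by rewrite loopS nth_cat hs ltnNge leq_addr /= addKn.
rewrite loopS nth_cat hs ifT; first by apply: IH => // j hj; apply: h; lia.
by apply: leq_trans (_ : i.+1 * r <= _); [rewrite mulSn; lia | rewrite leq_mul2r hi orbT].
Qed.

Lemma loop_surj n r b : size b = n * r ->
  b = loop n (fun i => mkseq (fun k => nth false b (i * r + k)) r).
Proof.
move=> sb; have sm i : i < n -> size (mkseq (fun k => nth false b (i * r + k)) r) = r.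
  by rewrite size_mkseq.
apply: (@eq_from_nth _ false) => [|p]; rewrite sb ?(size_loop sm) // => hp.
have r0 : 0 < r by lia.
rewrite {2}(divn_eq p r) (nth_loop sm) ?ltn_mod // ?nth_mkseq ?ltn_mod -?divn_eq //.
by rewrite ltn_divLR.
Qed.

Lemma loop_prod n m F : loop n (fun i => loop m (F i)) = loop (n * m) (fun u => F (u %/ m) (u %% m)).
Proof.
elim: n => [|n IH] //; rewrite loopS IH mulSnr /loop iotaD map_cat flatten_cat.
rewrite add0n -{3}(addn0 (n * m)) iotaDl -map_comp; congr (_ ++ flatten _).
apply/eq_in_map => k; rewrite mem_iota /= add0n => km.
by rewrite divnMDl ?modnMDl ?divn_small ?modn_small ?addn0 //; lia.
Qed.

Lemma loop_true n : loop n (fun=> [:: true]) = nseq n true.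
Proof. by rewrite /loop; elim: n 0 => [|n IH] i //=; rewrite IH. Qed.

(** Common form of both encodings, with entries indexed by numbers as in the programs; entries have
    1 bit for graphs and 2 for colored graphs. *)
Definition encb n (F : nat -> nat -> seq bool) :=
  nseq n true ++ false :: loop n (fun i => loop n (F i)).

Lemma loop_enum n (T : Type) (A : 'I_n -> T) (e : T -> seq bool) (F : nat -> seq bool) :
  (forall i : 'I_n, e (A i) = F i) -> flatten [seq e (A i) | i <- enum 'I_n] = loop n F.
Proof.
by move=> h; rewrite /loop -val_enum_ord -map_comp; congr flatten; apply: eq_map => i; apply: h.
Qed.

Lemma enc_graphE n (A : 'I_n -> 'I_n -> bool) (F : nat -> nat -> bool) :
  (forall i j : 'I_n, A i j = F i j) ->
  enc_graph A = encb n (fun i j => [:: F i j]).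
Proof.
move=> h; rewrite /enc_graph /encb; congr (_ ++ _ :: _).
apply: (@loop_enum n _ id (fun i => [seq A i j | j <- enum 'I_n])) => i.
rewrite -(@loop_enum n _ id (fun j => [:: A i j])) => [|j]; last by rewrite h.
by elim: (enum _) => [|j s IH] //=; rewrite IH.
Qed.

Lemma flatten_allpairs (S T R : Type) (f : S -> T -> seq R) s t :
  flatten [seq f x y | x <- s, y <- t] = flatten [seq flatten [seq f x y | y <- t] | x <- s].
Proof. by elim: s => [|x s IH] //=; rewrite flatten_cat IH. Qed.

Lemma enc_cgraphE n (C : 'I_n -> 'I_n -> 'I_3) (F : nat -> nat -> seq bool) :
  (forall i j : 'I_n, enc_color (C i j) = F i j) ->
  enc_cgraph C = encb n F.
Proof.
move=> h; rewrite /enc_cgraph /encb; congr (_ ++ _ :: _).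
rewrite -(@loop_enum n _ id (fun i => flatten [seq enc_color (C i j) | j <- enum 'I_n])) => [|i].
  exact: flatten_allpairs.
by apply: (@loop_enum n _ (C i) enc_color) => j; apply: h.
Qed.

Lemma enc_pairsE n m F : enc_pairs n m F =
  encb (n * m) (fun u v => F (u %/ m) (u %% m) (v %/ m) (v %% m)).
Proof.
rewrite /enc_pairs loop_prod loop_true /encb; congr (_ ++ _ :: _).
rewrite (loop_prod n m (fun i k => loop n (fun i' => loop m (F i k i')))).
by apply: eq_loop => u _; rewrite loop_prod.
Qed.

Section Blocks.
Variables (r n : nat) (F : nat -> nat -> seq bool).
Hypothesis rF : forall i j, i < n -> j < n -> size (F i j) = r.

Lemma size_rows i : i < n -> size (loop n (F i)) = n * r.
Proof. by move=> hi; apply: size_loop => j; apply: rF. Qed.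

Lemma size_body : size (loop n (fun i => loop n (F i))) = n * (n * r).
Proof. exact: size_loop size_rows. Qed.

Lemma size_encb : size (encb n F) = block_size r n.
Proof. by rewrite size_cat size_nseq /= size_body /block_size; lia. Qed.

Lemma nth_body i j d : i < n -> j < n -> d < r ->
  nth false (loop n (fun i => loop n (F i))) ((i * n + j) * r + d) = nth false (F i j) d.
Proof.
move=> hi hj hd; have -> : (i * n + j) * r + d = i * (n * r) + (j * r + d) by lia.
rewrite (nth_loop size_rows) //; last by nia.
by rewrite nth_loop // => k; apply: rF.
Qed.

Lemma entry_encb x y i j d : i < n -> j < n -> d < r ->
  entry r n (size x + (n + 1)) d (x ++ encb n F ++ y) i j = nth false (F i j) d.
Proof.
move=> hi hj hd; rewrite -(nth_body hi hj hd) /entry.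
have : (i * n + j) * r + d < n * (n * r).
  have hij : (i * n + j).+1 <= n * n by nia.
  rewrite mulnA; apply: leq_trans (_ : (i * n + j).+1 * r <= _); last by rewrite leq_mul2r hij orbT.
  by rewrite mulSn addnC ltn_add2r.
move: ((i * n + j) * r) => p hp.
rewrite nth_cat ifF; last by lia.
have -> : size x + (n + 1) + p + d - size x = n + (p + d).+1 by lia.
rewrite /encb -catA nth_cat size_nseq ifF; last by lia.
by rewrite addKn /= nth_cat size_body ifT.
Qed.
End Blocks.

Lemma index_encb n F x : index false (encb n F ++ x) = n.
Proof.
by rewrite /encb -catA cat_cons; move: (loop _ _ ++ x) => y; elim: n => //= n ->.
Qed.

(** The unary header determines the size and hence the length of the block, so the code is
    prefix-free and each entry can be read back at its offset. *)
Lemma encb_inj r n m F G x y :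
  (forall i j, i < n -> j < n -> size (F i j) = r) ->
  (forall i j, i < m -> j < m -> size (G i j) = r) ->
  encb n F ++ x = encb m G ++ y ->
  [/\ n = m, (forall i j, i < n -> j < n -> F i j = G i j) & x = y].
Proof.
move=> rF rG e; have nm : n = m by rewrite -(index_encb n F x) e index_encb.
move: e; rewrite -{m}nm in rG *; split=> // [i j hi hj|].
  apply: (@eq_from_nth _ false) => [|d]; rewrite rF ?rG // => hd.
  by have := entry_encb rF [::] x hi hj hd; rewrite cat0s e (entry_encb rG [::] y hi hj hd).
have hs : size (encb n F) = size (encb n G) by rewrite (size_encb rF) (size_encb rG).
by have := congr1 (drop (size (encb n F))) e; rewrite drop_size_cat // hs drop_size_cat.
Qed.

Lemma formatted_encb r n F G :
  (forall i j, i < n -> j < n -> size (F i j) = r) ->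
  (forall i j, i < n -> j < n -> size (G i j) = r) ->
  formatted r (encb n F ++ encb n G).
Proof.
move=> rF rG; rewrite /formatted index_encb.
have hF := size_encb rF; have hG := size_encb rG.
have nE t : nth false (encb n F ++ encb n G) (block_size r n + t) = nth false (encb n G) t.
  by rewrite nth_cat hF ltnNge leq_addr addKn.
rewrite size_cat hF hG eqxx /=; apply/andP; split.
  apply/hasPn => t; rewrite mem_iota /= => ht.
  by rewrite nE negbK nth_cat size_nseq ht nth_nseq ht.
by rewrite nE nth_cat size_nseq ltnn subnn.
Qed.

(** Any bits of the right length form a matrix, so checking lengths and headers is a complete syntax
    check. The first header is correct by the choice of [n]. *)
Lemma formattedP r w : formatted r w ->
  let n := index false w in
  let F b i j := mkseq (fun d => entry r n b d w i j) r in
  w = encb n (F (n + 1)) ++ encb n (F (block_size r n + (n + 1))).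
Proof.
move=> /and3P[] ; set n := index false w; set h := block_size r n => /eqP sw hn hh n0 F.
have body b : size b = n * (n * r) ->
    b = loop n (fun i => loop n (fun j => mkseq (fun d => nth false b ((i * n + j) * r + d)) r)).
  move=> sb; rewrite {1}(loop_surj sb); apply: eq_loop => i hi.
  rewrite {1}(@loop_surj n r (mkseq _ _)) ?size_mkseq //; apply: eq_loop => j hj.
  apply: (@eq_from_nth _ false) => [|d]; rewrite ?size_mkseq // => hd.
  rewrite !nth_mkseq //; last by apply: leq_trans (_ : j.+1 * r <= _);
    [rewrite mulSn addnC ltn_add2r | rewrite leq_mul2r hj orbT].
  by congr (nth _ _ _); lia.
(* One argument for both halves [v], where [b] is the offset of [v] in [w]. *)
have blk b v : size v = h -> (forall t, t < n -> nth false v t) -> ~~ nth false v n ->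
    (forall p, p < h -> nth false v p = nth false w (b + p)) ->
    v = encb n (F (b + (n + 1))).
  move=> sv h1 h2 vw.
  have sv' : size v = n + 1 + n * (n * r) by rewrite sv /h /block_size; lia.
  have hv : v = nseq n true ++ false :: drop (n + 1) v.
    rewrite -{1}(cat_take_drop n v); congr (_ ++ _).
      have st : size (take n v) = n by rewrite size_takel // sv'; lia.
      apply: (@eq_from_nth _ false) => [|i]; rewrite st ?size_nseq // => hi.
      by rewrite nth_take // nth_nseq hi h1.
    by rewrite (drop_nth false) ?addn1; [rewrite (negbTE h2) | lia].
  rewrite {1}hv /encb; congr (_ ++ _ :: _).
  rewrite [LHS]body ?size_drop ?sv'; last by lia.
  apply: eq_loop => i hi; apply: eq_loop => j hj.
  apply: (@eq_from_nth _ false) => [|d]; rewrite ?size_mkseq // => hd.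
  rewrite !nth_mkseq // nth_drop vw.
    by rewrite /entry; congr nth; lia.
  have hij : (i * n + j).+1 <= n * n by nia.
  have : (i * n + j).+1 * r <= n * n * r by rewrite leq_mul2r hij orbT.
  by rewrite mulSn /h /block_size; lia.
have sw1 : size (take h w) = h by rewrite size_takel // sw leq_addr.
have sw2 : size (drop h w) = h by rewrite size_drop sw addnK.
have hnp : n < h by rewrite /h /block_size; lia.
rewrite -{1}(cat_take_drop h w); congr (_ ++ _).
  rewrite -[n + 1]/(0 + (n + 1)); apply: blk => // [t ht||p hp]; rewrite nth_take //; try lia.
  - by have := before_find false ht; rewrite /= eqbF_neg => /negbFE.
  - have : n < size w by rewrite sw; lia.
    by rewrite /n index_mem => /(nth_index false) ->.
apply: blk => // [t ht||p hp]; rewrite nth_drop //.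
by move/hasPn: hn => /(_ t); rewrite mem_iota /= ht negbK => ->.
Qed.

(** * Literal-clause graphs *)

(** Covers [graph_iso] and [cgraph_iso]; arbitrary vertex types allow the targets to be studied on
    pairs before they are numbered. *)
Definition iso (T U X : Type) (F : T -> T -> X) (G : U -> U -> X) :=
  exists f : T -> U, bijective f /\ forall x y, F x y = G (f x) (f y).

Lemma iso_ext (T X : Type) (F G : T -> T -> X) : (forall x y, F x y = G x y) -> iso F G.
Proof. by move=> FG; exists id; split=> //; exists id. Qed.

Lemma iso_sym (T U X : Type) (F : T -> T -> X) (G : U -> U -> X) : iso F G -> iso G F.
Proof.
move=> [f [[g fK gK] h]]; exists g; split; first by exists f.
by move=> x y; rewrite h !gK.
Qed.

Lemma iso_trans (T U V X : Type) (F : T -> T -> X) (G : U -> U -> X) (H : V -> V -> X) :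
  iso F G -> iso G H -> iso F H.
Proof.
move=> [f [bf hf]] [g [bg hg]]; exists (g \o f); split; first exact: bij_comp.
by move=> x y; rewrite hf hg.
Qed.

Lemma inj_surj_bij (T : choiceType) (U : eqType) (f : T -> U) :
  injective f -> (forall y, exists x, f x == y) -> bijective f.
Proof.
move=> fI fS; exists (fun y => xchoose (fS y)) => [x|y]; last exact/eqP/(xchooseP (fS y)).
by apply: fI; apply/eqP/(xchooseP (fS _)).
Qed.

Definition is_lit (T : finType) (C : T -> T -> 'I_3) (x : T) := [exists y, val (C x y) == 2].

(** Local conditions that characterize the graphs of 3-SAT formulas up to isomorphism: vertices with
    an edge of color 2 are the literals, all others the clauses. *)
Record lcn_graph (T : finType) (C : T -> T -> 'I_3) : Prop := LcnGraph {
  lcn_sym : forall x y, C x y = C y x;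
  lcn_irr : forall x, val (C x x) = 0;
  lcn_mate : forall x y z, val (C x y) = 2 -> val (C x z) = 2 -> y = z;
  lcn_bip : forall x y, val (C x y) = 1 -> is_lit C x != is_lit C y;
  lcn_deg : forall x, ~~ is_lit C x -> #|[pred y | val (C x y) == 1]| <= 3 }.

Lemma iso_lcn_graph (T U : finType) (C : T -> T -> 'I_3) (D : U -> U -> 'I_3) :
  iso C D -> lcn_graph D -> lcn_graph C.
Proof.
move=> [f [bf h]] [dsym dirr dmate dbip ddeg].
have fI : injective f by apply: bij_inj.
have litE x : is_lit C x = is_lit D (f x).
  apply/existsP/existsP => [[y hy]|[y hy]]; first by exists (f y); rewrite -h.
  by case: bf => g fK gK; exists (g y); rewrite h gK.
split.
- by move=> x y; rewrite !h.
- by move=> x; rewrite h.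
- by move=> x y z; rewrite !h => h1 h2; apply/fI/(dmate _ _ _ h1 h2).
- by move=> x y; rewrite h !litE; apply: dbip.
- move=> x; rewrite litE => /ddeg; apply: leq_trans.
  rewrite -(card_imset _ fI); apply/subset_leq_card/subsetP => _ /imsetP[y hy ->].
  by move: hy; rewrite !inE h.
Qed.

Lemma val_LCN n cls i j : val (@LCN n cls i j) = LCN_col_nat cls i j.
Proof. by rewrite /LCN /= inordK // /LCN_col_nat; do !case: ifP. Qed.

Lemma lcn_graph_LCN n (cls : seq (seq ('I_n * bool))) :
  is_3SAT cls -> lcn_graph (LCN cls).
Proof.
move=> /allP sat.
have c2 (i j : nat) : LCN_col_nat cls i j = 2 <->
    [&& i < 2 * n, j < 2 * n, i != j & i./2 == j./2].
  by rewrite /LCN_col_nat; do !case: ifP => //; lia.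
have litE i : is_lit (LCN cls) i = (i < 2 * n).
  apply/existsP/idP => [[j]|hi]; first by rewrite val_LCN => /eqP/c2 /and4P[].
  have hj : (if odd i then i.-1 else i.+1) < 2 * n + size cls by case: ifP; lia.
  by exists (Ordinal hj); rewrite val_LCN /=; apply/eqP/c2; case: ifP; lia.
split.
- move=> i j; apply: val_inj; rewrite !val_LCN /LCN_col_nat [in RHS]eq_sym [i./2 == _]eq_sym.
  by case: ltnP => hi; case: ltnP => hj; rewrite /= ?andbT ?andbF.
- by move=> i; rewrite val_LCN /LCN_col_nat; do !case: ifP; lia.
- move=> i j k; rewrite !val_LCN => /c2 h1 /c2 h2; apply: val_inj => /=; lia.
- move=> i j; rewrite val_LCN !litE /LCN_col_nat; do !case: ifP => //; lia.
- move=> i; rewrite litE -leqNgt => hi.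
  set c := nth [::] cls (i - 2 * n).
  have hc : c \in cls by apply: mem_nth; rewrite ltn_subLR.
  (* The neighbours of a clause vertex are indices of its distinct literals. *)
  apply: leq_trans (sat _ hc); rewrite -(size_map (@lit_index n) (undup c)).
  rewrite cardE -(size_map val); apply: uniq_leq_size.
    by rewrite map_inj_uniq ?enum_uniq //; apply: val_inj.
  move=> _ /mapP[j + ->]; rewrite mem_enum inE val_LCN /LCN_col_nat.
  rewrite ltnNge hi /=; case: ltnP => //= hj.
  case: ifP => // /hasP[l lc /eqP <-] _.
  by apply/mapP; exists l => //; rewrite mem_undup.
Qed.

(** * Reconstruction of a formula from a colored graph *)

Section Formula.
Variables (N : nat) (C : 'I_N.+1 -> 'I_N.+1 -> 'I_3).
Hypothesis lcnC : lcn_graph C.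

Definition mate (x : 'I_N.+1) := odflt x [pick y | val (C x y) == 2].

Lemma mateP x : is_lit C x -> val (C x (mate x)) = 2.
Proof.
by rewrite /mate => /existsP[y hy]; case: pickP => [z /eqP|/(_ y)]; rewrite ?hy.
Qed.

Lemma mate_uniq x y : val (C x y) = 2 -> y = mate x.
Proof. by move=> h; apply: (lcn_mate lcnC h); apply: mateP; apply/existsP; exists y; rewrite h. Qed.

Lemma lit_mate x : is_lit C x -> is_lit C (mate x).
Proof. by move=> /mateP h; apply/existsP; exists x; rewrite (lcn_sym lcnC) h. Qed.

Lemma mateK x : is_lit C x -> mate (mate x) = x.
Proof. by move=> h; apply/esym/mate_uniq; rewrite (lcn_sym lcnC) mateP. Qed.

Lemma mate_neq x : is_lit C x -> mate x != x.
Proof. by move=> /mateP h; apply/eqP => e; rewrite e (lcn_irr lcnC) in h. Qed.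

(** One representative per complementary pair; taking the smaller vertex as the positive literal is
    an arbitrary choice of sign. These vertices are the variables. *)
Definition positives := [seq x <- enum 'I_N.+1 | is_lit C x && (x < mate x)].
Definition clauses := [seq x <- enum 'I_N.+1 | ~~ is_lit C x].

Notation k := (size positives).

Definition litv (a : nat) (b : bool) :=
  let x := nth ord0 positives a in if b then mate x else x.

Definition formula : seq (seq ('I_k * bool)) :=
  [seq [seq l : 'I_k * bool <- enum {: 'I_k * bool} | val (C x (litv l.1 l.2)) == 1] | x <- clauses].

Lemma positives_lit a : a < k -> is_lit C (nth ord0 positives a) /\
  nth ord0 positives a < mate (nth ord0 positives a).
Proof. by move=> /(mem_nth ord0); rewrite mem_filter => /andP[/andP[]]. Qed.

Lemma clauses_nlit c : c < size clauses -> ~~ is_lit C (nth ord0 clauses c).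
Proof. by move=> /(mem_nth ord0); rewrite mem_filter => /andP[]. Qed.

Lemma litv_lit a b : a < k -> is_lit C (litv a b).
Proof. by move=> /positives_lit[h _]; rewrite /litv; case: b => //; apply: lit_mate. Qed.

Lemma litv_inj a b a' b' : a < k -> a' < k -> litv a b = litv a' b' -> a = a' /\ b = b'.
Proof.
move=> ak ak'; rewrite /litv; have [h1 h2] := positives_lit ak; have [h1' h2'] := positives_lit ak'.
have U : uniq positives by rewrite filter_uniq // enum_uniq.
have inj : nth ord0 positives a = nth ord0 positives a' -> a = a'.
  by move/eqP; rewrite nth_uniq // => /eqP.
case: b; case: b' => e.
- by split=> //; apply: inj; rewrite -(mateK h1) e mateK.
- by move: h2 h2'; rewrite -e mateK //; lia.
- by move: h2 h2'; rewrite e mateK //; lia.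
- by split=> //; apply: inj.
Qed.

Lemma litv_surj x : is_lit C x -> exists a b, a < k /\ x = litv a b.
Proof.
move=> hx; have [h|h] := ltnP x (mate x).
  have xp : x \in positives by rewrite mem_filter hx h mem_enum.
  by exists (index x positives), false; rewrite index_mem xp /litv nth_index.
have xp : mate x \in positives.
  rewrite mem_filter lit_mate // mateK // mem_enum andbT /=.
  by rewrite ltn_neqAle h andbT; apply: mate_neq.
by exists (index (mate x) positives), true; rewrite index_mem xp /litv nth_index // mateK.
Qed.

Lemma formula_3SAT : is_3SAT formula.
Proof.
apply/allP => _ /mapP[x hx ->].
have nx : ~~ is_lit C x by move: hx; rewrite mem_filter => /andP[].
apply: leq_trans (lcn_deg lcnC nx).
rewrite undup_id; last exact/filter_uniq/enum_uniq.
rewrite [leqRHS]cardE.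
rewrite -(size_map (fun l : 'I_k * bool => litv l.1 l.2)); apply: uniq_leq_size.
  rewrite map_inj_uniq => [|[a b] [a' b'] /=]; first exact/filter_uniq/enum_uniq.
  by move=> /litv_inj[]// /val_inj -> ->.
by move=> _ /mapP[l + ->]; rewrite mem_filter !mem_enum inE => /andP[].
Qed.

Definition vertex (u : nat) : 'I_N.+1 :=
  if u < 2 * k then litv u./2 (odd u) else nth ord0 clauses (u - 2 * k).

Lemma size_formula : size formula = size clauses.
Proof. by rewrite size_map. Qed.

Lemma C01 x y : val (C x y) <> 2 -> val (C x y) <> 1 -> val (C x y) = 0.
Proof. by move: (C x y) => [[|[|[|c]]] hc]. Qed.

Lemma vertex_LCN (u v : 'I_(2 * k + size formula)) : C (vertex u) (vertex v) = LCN formula u v.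
Proof.
apply: val_inj; rewrite val_LCN /LCN_col_nat /vertex.
have cl (u' : 'I_(2 * k + size formula)) : 2 * k <= u' -> u' - 2 * k < size clauses.
  by move=> h; rewrite ltn_subLR // -size_formula.
have nolit x y : ~~ is_lit C x -> val (C x y) <> 2.
  by move=> /existsPn/(_ y)/eqP.
have adj a (b : bool) c : a < k -> c < size clauses ->
  has (fun l : 'I_k * bool => lit_index l == 2 * a + b) (nth [::] formula c) =
  (val (C (nth ord0 clauses c) (litv a b)) == 1).
  move=> ak hc; rewrite (nth_map ord0) //; apply/hasP/idP => [[[a' b']]|h].
    rewrite mem_filter /lit_index /= => /andP[h _] /eqP e.
    have {}e : 2 * a' + b' = 2 * a + b := e.
    have ea : a' = a :> nat by case: (b) (b') e => -[] /=; lia.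
    have <- : b' = b by case: (b) (b') e => -[] //=; lia.
    rewrite -ea.
    exact: h.
  exists (Ordinal ak, b); last by rewrite /lit_index.
  by rewrite mem_filter mem_enum h.
have split2 (x : nat) : x = 2 * x./2 + odd x by rewrite mul2n addnC odd_double_half.
case: (ltnP u (2 * k)) => hu; case: (ltnP v (2 * k)) => hv /=.
- have hu2 : u./2 < k by lia.
  have hv2 : v./2 < k by lia.
  case: ifP => [/andP[uv /eqP e]|h].
    have -> : odd v = ~~ odd u by move: uv e (split2 u) (split2 v); case: (odd u); case: (odd v) => /=; lia.
    rewrite -e /litv; have [h1 h2] := positives_lit hu2.
    by case: (odd u) => /=; [rewrite (lcn_sym lcnC) |]; apply: mateP.
  (* Color 2 would make the two literals mates, and color 1 never joins two literals. *)
  apply: C01.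
    move=> /mate_uniq e; move: h.
    have [hl hl'] := positives_lit hu2.
    have [ev eo] : v./2 = u./2 /\ odd v = ~~ odd u.
      apply: litv_inj => //; rewrite e /litv; case: (odd u) => //=.
      by rewrite mateK.
    by rewrite ev eqxx andbT => /negbFE/eqP uv; rewrite uv in eo; case: (odd v) eo.
  by move=> /(lcn_bip lcnC); rewrite !litv_lit.
- have hu2 : u./2 < k by lia.
  have := adj u./2 (odd u) _ hu2 (cl _ hv); rewrite -split2 => ->.
  rewrite (lcn_sym lcnC); case: eqP => // h1; apply: C01 => //.
  by apply/nolit/clauses_nlit/cl.
- have hv2 : v./2 < k by lia.
  have := adj v./2 (odd v) _ hv2 (cl _ hu); rewrite -split2 => ->.
  case: eqP => // h1; apply: C01 => //.
  by apply/nolit/clauses_nlit/cl.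
- have nu := clauses_nlit (cl _ hu); have nv := clauses_nlit (cl _ hv).
  apply: C01; first exact: nolit.
  by move=> /(lcn_bip lcnC); rewrite (negbTE nu) (negbTE nv).
Qed.

Lemma vertex_bij : bijective (fun u : 'I_(2 * k + size formula) => vertex u).
Proof.
have cl (u' : 'I_(2 * k + size formula)) : 2 * k <= u' -> u' - 2 * k < size clauses.
  by move=> h; rewrite ltn_subLR // -size_formula.
apply: inj_surj_bij => [u v|x].
  rewrite /vertex; case: (ltnP u (2 * k)) => hu; case: (ltnP v (2 * k)) => hv e.
  - have [|| e1 e2] := litv_inj _ _ e; [by lia.. |].
    by apply: ord_inj; rewrite -(odd_double_half u) -(odd_double_half v) e1 e2.
  - by have := clauses_nlit (cl _ hv); rewrite -e litv_lit //; lia.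
  - by have := clauses_nlit (cl _ hu); rewrite e litv_lit //; lia.
  - have U : uniq clauses by exact/filter_uniq/enum_uniq.
    move/eqP: e; rewrite nth_uniq ?cl // => /eqP e.
    by apply: ord_inj; lia.
case: (boolP (is_lit C x)) => hx.
  have [a [b [ak ->]]] := litv_surj hx.
  have hu : 2 * a + b < 2 * k + size formula by case: b; lia.
  exists (Ordinal hu); rewrite /vertex [nat_of_ord _]/=.
  have -> : 2 * a + b < 2 * k by case: (b); lia.
  by rewrite mul2n addnC half_bit_double oddD odd_double oddb addbF.
have xc : x \in clauses by rewrite mem_filter hx mem_enum.
have hu : 2 * k + index x clauses < 2 * k + size formula.
  by rewrite ltn_add2l size_formula index_mem.
by exists (Ordinal hu); rewrite /vertex /= ltnNge leq_addr /= addKn nth_index.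
Qed.

End Formula.

(** This turns the existence of a formula in [GI_SAT] into a condition that a program can check. *)
Lemma lcn_graphP N (C : 'I_N -> 'I_N -> 'I_3) : lcn_graph C <->
  exists k (f : seq (seq ('I_k * bool))), is_3SAT f /\ cgraph_iso C (LCN f).
Proof.
split=> [lcnC|[k [f [sat h]]]]; last exact: iso_lcn_graph h (lcn_graph_LCN sat).
(* The reconstruction uses [ord0] as a default vertex, so the graph without vertices is treated
   apart, with the formula without variables and clauses. *)
case: N C lcnC => [|N] C lcnC.
  exists 0, [::]; split=> //; exists id; split; first by exists id.
  by case.
exists (size (positives C)), (formula C); split; first exact: formula_3SAT.
apply: iso_sym; exists (fun u => vertex C u); split; first exact: vertex_bij.
by move=> u v; rewrite vertex_LCN.
Qed.

(** * Correctness of the reductions *)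

Definition nat_ext (T : Type) (d : T) n (A : 'I_n -> 'I_n -> T) (i j : nat) : T :=
  if insub i is Some i' then if insub j is Some j' then A i' j' else d else d.

Lemma nat_extE (T : Type) (d : T) n (A : 'I_n -> 'I_n -> T) (i j : 'I_n) :
  nat_ext d A i j = A i j.
Proof. by rewrite /nat_ext !valK. Qed.

Lemma enc_color_inj : injective enc_color.
Proof. by move=> [[|[|[|c]]] hc] [[|[|[|d]]] hd] // _; apply: val_inj. Qed.

Lemma enc_graph_nat n (A : 'I_n -> 'I_n -> bool) :
  enc_graph A = encb n (fun i j => [:: nat_ext false A i j]).
Proof. by apply: enc_graphE => i j; rewrite nat_extE. Qed.

Lemma enc_cgraph_nat n (C : 'I_n -> 'I_n -> 'I_3) :
  enc_cgraph C = encb n (fun i j => enc_color (nat_ext ord0 C i j)).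
Proof. by apply: enc_cgraphE => i j; rewrite nat_extE. Qed.

Lemma enc_graph_inj n m (A : 'I_n -> 'I_n -> bool) (A' : 'I_m -> 'I_m -> bool) x y :
  enc_graph A ++ x = enc_graph A' ++ y -> iso A A' /\ x = y.
Proof.
rewrite !enc_graph_nat => /(@encb_inj 1)[]// nm h ->; split=> //.
subst m; apply: iso_ext => i j.
by have [] := h i j (ltn_ord i) (ltn_ord j); rewrite !nat_extE.
Qed.

Lemma enc_cgraph_inj n m (A : 'I_n -> 'I_n -> 'I_3) (A' : 'I_m -> 'I_m -> 'I_3) x y :
  enc_cgraph A ++ x = enc_cgraph A' ++ y -> iso A A' /\ x = y.
Proof.
rewrite !enc_cgraph_nat => /(@encb_inj 2)[]// nm h ->; split=> //.
subst m; apply: iso_ext => i j.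
by have /enc_color_inj := h i j (ltn_ord i) (ltn_ord j); rewrite !nat_extE.
Qed.

Lemma iso_simple n m (A : 'I_n -> 'I_n -> bool) (B : 'I_m -> 'I_m -> bool) :
  iso A B -> simple_graph B -> simple_graph A.
Proof. by move=> [f [_ h]] [s i]; split=> *; rewrite !h. Qed.

(** Decoding is stated up to [iso], which avoids transport along an equality of vertex counts;
    simplicity and isomorphism are both invariant. *)
Lemma GI_enc n m (A : 'I_n -> 'I_n -> bool) (B : 'I_m -> 'I_m -> bool) :
  GI (enc_graph A ++ enc_graph B) <->
  [/\ simple_graph A, simple_graph B & iso A B].
Proof.
split=> [[n' [m' [A' [B' [e [sA' [sB' iAB]]]]]]]|[sA sB iAB]]; last by exists n, m, A, B.
have [iA eB] := enc_graph_inj e.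
have [iB _] : iso B B' /\ [::] = [::] :> seq bool by apply: enc_graph_inj; rewrite !cats0.
split; [exact: iso_simple iA _|exact: iso_simple iB _|].
exact: iso_trans iA (iso_trans iAB (iso_sym iB)).
Qed.

Lemma GI_SAT_enc n m (C : 'I_n -> 'I_n -> 'I_3) (D : 'I_m -> 'I_m -> 'I_3) :
  GI_SAT (enc_cgraph C ++ enc_cgraph D) <->
  [/\ lcn_graph C, lcn_graph D & iso C D].
Proof.
split=> [[n' [m' [C' [D' [e [/lcn_graphP sC [/lcn_graphP sD iCD]]]]]]]|[sC sD iCD]]; last first.
  by exists n, m, C, D; split=> //; split; [apply/lcn_graphP | split=> //; apply/lcn_graphP].
have [iC eD] := enc_cgraph_inj e.
have [iD _] : iso D D' /\ [::] = [::] :> seq bool by apply: enc_cgraph_inj; rewrite !cats0.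
split; [exact: iso_lcn_graph iC sC|exact: iso_lcn_graph iD sD|].
exact: iso_trans iC (iso_trans iCD (iso_sym iD)).
Qed.

Lemma iso_ord_eq n m (T : Type) (A : 'I_n -> 'I_n -> T) (B : 'I_m -> 'I_m -> T) :
  iso A B -> n = m.
Proof. by move=> [f [bf _]]; rewrite -(card_ord n) -(card_ord m) (bij_eq_card bf). Qed.

Lemma GI_formatted w : GI w -> formatted 1 w.
Proof.
move=> [n [m [A [B [-> [_ [_ iAB]]]]]]]; have nm := iso_ord_eq iAB; subst m.
by rewrite !enc_graph_nat; apply: formatted_encb.
Qed.

(** The empty word is the output on rejected inputs; it is no code, because every block contains the
    zero that ends its header. *)
Lemma not_GI_nil : ~ GI [::].
Proof. by move=> [n [m [A [B []]]]]; rewrite enc_graph_nat /encb; case: n A. Qed.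

Lemma not_GI_SAT_nil : ~ GI_SAT [::].
Proof. by move=> [n [m [A [B []]]]]; rewrite enc_cgraph_nat /encb; case: n A. Qed.

Lemma has_ord n (a : pred nat) : has a (iota 0 n) = [exists i : 'I_n, a i].
Proof.
apply/hasP/existsP => [[i]|[i ai]]; last by exists (i : nat) => //; rewrite mem_iota /=.
by rewrite mem_iota /= => hi ai; exists (Ordinal hi).
Qed.

Lemma count_ord n (a : pred nat) : count a (iota 0 n) = #|[pred i : 'I_n | a i]|.
Proof. by rewrite -val_enum_ord count_map -sum1_count big_enum_cond /= sum1_card. Qed.

Lemma bad_graphP n (A : nat -> nat -> bool) :
  ~~ bad_graph n A <-> simple_graph (fun i j : 'I_n => A i j).
Proof.
rewrite /bad_graph has_ord; split=> [/existsPn h|[s ir]].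
  split=> [i j|i]; [have := h i; rewrite has_ord => /existsPn/(_ j) |
    have := h i; rewrite has_ord => /existsPn/(_ i)].
    by rewrite negb_or negbK => /andP[/eqP].
  by rewrite negb_or !eqxx /= => /negbTE.
apply/existsPn => i; rewrite has_ord; apply/existsPn => j.
by rewrite s eqxx /=; case: eqP => //= /val_inj ->; rewrite ir.
Qed.

Lemma bad_cgraphP n (c1 c2 : nat -> nat -> bool) (C : 'I_n -> 'I_n -> 'I_3) :
  (forall i j : 'I_n, c1 i j = (val (C i j) == 1)) ->
  (forall i j : 'I_n, c2 i j = (val (C i j) == 2)) ->
  ~~ bad_cgraph n c1 c2 <-> lcn_graph C.
Proof.
move=> h1 h2.
have litE (i : 'I_n) : lit n c2 i = is_lit C i.
  by rewrite /lit has_ord; apply: eq_existsb => j; rewrite h2.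
have degE (i : 'I_n) : count (fun j => c1 i j) (iota 0 n) = #|[pred j | val (C i j) == 1]|.
  by rewrite count_ord; apply: eq_card => j; rewrite !inE h1.
rewrite /bad_cgraph negb_or !has_ord; split=> [/andP[/existsPn H1 /existsPn H2]|[sym irr mate bip deg]].
  have {}H1 (i j : 'I_n) : [&& c1 i j == c1 j i, c2 i j == c2 j i,
      (i == j :> nat) ==> ~~ (c1 i j || c2 i j), c1 i j ==> (is_lit C i != is_lit C j) &
      c2 i j ==> [forall k : 'I_n, c2 i k ==> (j == k :> nat)]].
    have := H1 i; rewrite has_ord => /existsPn/(_ j).
    rewrite !negb_or !negbK !litE has_ord => /and5P[_ -> -> e1 /andP[e2 e3]] /=.
    move: e1 e2; rewrite !negb_and !implybE !negb_or ?negbK => -> -> /=.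
    case: (c2 i j) e3 => //= /existsPn h; apply/forallP => k.
    by have := h k; rewrite negb_and negbK implybE.
  have sym i j : C i j = C j i.
    apply: enc_color_inj; have /and3P[e1 e2 _] := H1 i j.
    by rewrite /enc_color -!h1 -!h2 (eqP e1) (eqP e2).
  split=> // [i|i j k hij hik|i j hij|i].
  - have /and3P[_ _ /andP[+ _]] := H1 i i; rewrite eqxx h1 h2 /=.
    by case: (C i i) => -[|[|[|c]]].
  - have /and5P[_ _ _ _] := H1 i j; rewrite h2 hij => /forallP/(_ k).
    by rewrite h2 hik => /eqP/val_inj.
  - by have /and5P[_ _ _ + _] := H1 i j; rewrite h1 hij.
  - by have := H2 i; rewrite litE degE negb_and negbK -leqNgt => /orP[->|].
apply/andP; split; apply/existsPn => i.
  rewrite has_ord; apply/existsPn => j.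
  rewrite has_ord !litE !h1 !h2 !(sym j i) !eqxx /= !negb_or.
  apply/and4P; split.
  - by case: (C i j) => -[|[|[|c]]].
  - by case: eqP => // /val_inj <-; rewrite irr.
  - by case: eqP => // /bip ->.
  - case: eqP => //= hij; apply/existsPn => k; rewrite h2.
    by case: eqP => //= hik; rewrite negbK (mate _ _ _ hij hik).
by rewrite litE degE; case: (boolP (is_lit C i)) => //= /deg; rewrite -leqNgt.
Qed.

Definition color (b1 b2 : bool) : 'I_3 :=
  if b1 then @Ordinal 3 1 isT else if b2 then @Ordinal 3 2 isT else ord0.

Lemma color1 b1 b2 : (val (color b1 b2) == 1) = b1.
Proof. by case: b1 b2 => -[]. Qed.

Lemma color2 b1 b2 : ~~ (b1 && b2) -> (val (color b1 b2) == 2) = b2.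
Proof. by case: b1 b2 => -[]. Qed.

Lemma enc_color_color b1 b2 : ~~ (b1 && b2) -> enc_color (color b1 b2) = [:: b1; b2].
Proof. by case: b1 b2 => -[]. Qed.

(** * From graphs to literal-clause graphs *)

Section LcnOfGraph.
Variable n : nat.

Notation V := ('I_n * ('I_n + bool))%type.
Implicit Types (A B : 'I_n -> 'I_n -> bool) (u v : V).

(** [inl k] labels the clause of the pair [(i, k)], [inr false] the literal x_i and [inr true] its
    negation. Clauses contain positive literals only. *)
Definition incident A u v :=
  match u.2, v.2 with
  | inl k, inr false => A u.1 k && ((v.1 == u.1) || (v.1 == k))
  | _, _ => false
  end.

Definition opposite u v :=
  match u.2, v.2 with
  | inr b, inr b' => (u.1 == v.1) && (b != b')
  | _, _ => false
  end.

Definition lcn_of A u v := color (incident A u v || incident A v u) (opposite u v).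

Lemma lcn_excl A u v : ~~ ((incident A u v || incident A v u) && opposite u v).
Proof. by case: u v => [i [k|[]]] [i' [k'|[]]]; rewrite /incident /opposite /= ?andbF. Qed.

Lemma lcn_of1 A u v : (val (lcn_of A u v) == 1) = incident A u v || incident A v u.
Proof. exact: color1. Qed.

Lemma lcn_of2 A u v : (val (lcn_of A u v) == 2) = opposite u v.
Proof. exact/color2/lcn_excl. Qed.

Lemma is_lit_lcn_of A u : is_lit (lcn_of A) u = if u.2 is inr _ then true else false.
Proof.
apply/existsP/idP => [[v]|]; first by rewrite lcn_of2 /opposite; case: u.2.
case: u => [i [k|b]] //= _; exists (i, inr (~~ b)).
by rewrite lcn_of2 /opposite /= eqxx; case: b.
Qed.

Lemma lcn_graph_of A : lcn_graph (lcn_of A).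
Proof.
split.
- move=> u v; rewrite /lcn_of orbC; congr color.
  by case: u v => [i [k|b]] [i' [k'|b']]; rewrite /opposite //= eq_sym [b == _]eq_sym.
- by move=> [i [k|[]]]; rewrite /lcn_of /incident /opposite /= ?eqxx ?andbF.
- move=> u v v' /eqP; rewrite lcn_of2 => h1 /eqP; rewrite lcn_of2.
  case: u v v' h1 => [i [k|b]] [i1 [k1|b1]] [i2 [k2|b2]]; rewrite /opposite //=.
  by move=> /andP[/eqP <- h] /andP[/eqP <- h']; case: b b1 b2 h h' => -[] [].
- move=> u v /eqP; rewrite lcn_of1 !is_lit_lcn_of.
  by case: u v => [i [k|[]]] [i' [k'|[]]].
move=> [i [k|b]]; rewrite is_lit_lcn_of //= => _.
apply: leq_trans (_ : #|[set (i, inr false : 'I_n + bool); (k, inr false : 'I_n + bool)]| <= _);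
  last by rewrite cards2; case: eqP.
apply/subset_leq_card/subsetP => v; rewrite inE lcn_of1.
case: v => [j [k'|[]]]; rewrite /incident //= ?orbF => /andP[_].
by rewrite !inE => /orP[/eqP-> | /eqP->]; rewrite !eqxx ?orbT.
Qed.

Lemma iso_lcn_of A B : iso A B -> iso (lcn_of A) (lcn_of B).
Proof.
move=> [f [bf h]]; have fI := bij_inj bf; have [g fK gK] := bf.
exists (fun u => (f u.1, match u.2 with inl k => inl (f k) | inr b => inr b end)); split.
  exists (fun u => (g u.1, match u.2 with inl k => inl (g k) | inr b => inr b end)).
    by move=> [i [k|b]]; rewrite /= ?fK.
  by move=> [i [k|b]]; rewrite /= ?gK.
have inc_f u v : incident A u v = incident B
   (f u.1, match u.2 with inl k => inl (f k) | inr b => inr b end)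
   (f v.1, match v.2 with inl k => inl (f k) | inr b => inr b end).
  by case: u v => [i [k|[]]] [i' [k'|[]]]; rewrite /incident //= h !(inj_eq fI).
move=> u v; rewrite /lcn_of -!inc_f; congr color.
by case: u v => [i [k|b]] [i' [k'|b']]; rewrite /opposite //= (inj_eq fI).
Qed.

(* The right-hand side only mentions notions preserved by isomorphisms. *)
Lemma edge_lcn_of A i k : simple_graph A ->
  A i k <-> i != k /\ exists u b b', val (lcn_of A u (i, inr b)) = 1 /\ 
    val (lcn_of A u (k, inr b')) = 1.
Proof.
move=> [s ir]; split=> [Aik|[ik [u [b [b' [/eqP + /eqP]]]]]].
  split; first by apply: contraTneq Aik => ->; rewrite ir.
  exists (i, inl k), false, false; split; apply/eqP;
  by rewrite lcn_of1 /incident /= Aik eqxx ?orbT.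
rewrite !lcn_of1; case: u => [p [q|c]]; case: b; case: b'; rewrite /incident //= ?orbF.
move=> /andP[Apq h1] /andP[_ h2]; case/orP: h1 h2 ik => /eqP-> /orP[] /eqP->; rewrite ?eqxx //.
by rewrite s.
Qed.

(** An isomorphism may flip the sign of a variable, so only the underlying variable [s i] is kept;
    the edge criterion quantifies over signs and is therefore transported. *)
Lemma lcn_of_iso A B : simple_graph A -> simple_graph B ->
  iso (lcn_of A) (lcn_of B) -> iso A B.
Proof.
move=> sA sB [f [bf h]]; have fI := bij_inj bf; have [g fK gK] := bf.
have opp u v : opposite u v = opposite (f u) (f v) by rewrite -(lcn_of2 A) h lcn_of2.
pose s i := (f (i, inr false)).1.
have fs i b : exists c, f (i, inr b) = (s i, inr c).
  have : opposite (i, inr b) (i, inr (~~ b)) by rewrite /opposite /= eqxx; case: b.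
  rewrite opp /s; case: b; rewrite /= /opposite;
  case: (f (i, inr true)) (f (i, inr false)) => [j [l|c]] [j' [l'|c']] //= /andP[/eqP e _];
  by [exists c; rewrite e | exists c'].
(* The two literals of [i] have distinct images among the two literals of [s i], so every sign is
   reached. *)
have sf i c : exists b, f (i, inr b) = (s i, inr c).
  have [c1 h1] := fs i true; have [c2 h2] := fs i false.
  have : c1 != c2.
    by apply: contraTneq isT => e; have := fI (i, inr true) (i, inr false); rewrite h1 h2 e => /(_ erefl).
  by case: c c1 c2 h1 h2 => -[] [] //= h1 h2 _; by [exists true | exists false].
have sI : injective s.
  move=> i j e; have [c hc] := fs i false; have [b hb] := sf j c.
  by have [] : (i, inr false) = (j, inr b) :> V by apply: fI; rewrite hc hb e.
exists s; split; first exact: injF_bij.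
move=> i k; apply/idP/idP => /edge_lcn_of.
  move=> /(_ sA)[ik [u [b [b' [h1 h2]]]]]; apply/edge_lcn_of => //.
  split; first by rewrite (inj_eq sI).
  have [c hc] := fs i b; have [c' hc'] := fs k b'.
  by exists (f u), c, c'; rewrite -hc -hc' -!h.
move=> /(_ sB)[ik [u [c [c' [h1 h2]]]]]; apply/edge_lcn_of => //.
split; first by apply: contraNneq ik => ->.
have [b hb] := sf i c; have [b' hb'] := sf k c'.
by exists (g u), b, b'; rewrite !h gK hb hb'.
Qed.

End LcnOfGraph.

(** * From literal-clause graphs to graphs *)

Section GraphOfLcn.
Variable n : nat.

Notation W := ('I_n * 'I_4)%type.
Implicit Types (C D : 'I_n -> 'I_n -> 'I_3) (u v : W).

Definition plain_of C u v : bool :=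
  if val u.2 == 0 then if val v.2 == 0 then val (C u.1 v.1) == 1 else u.1 == v.1
  else if val v.2 == 0 then u.1 == v.1
  else [&& val u.2 == 1, val v.2 == 1 & val (C u.1 v.1) == 2].

Lemma plain_simple C : lcn_graph C ->
  (forall u v, plain_of C u v = plain_of C v u) /\ forall u, plain_of C u u = false.
Proof.
move=> [sym irr _ _ _]; split=> [[i k] [j l]|[i k]]; rewrite /plain_of /=; last first.
  by rewrite irr !andbF; case: (_ == _).
rewrite (sym j) [j == _]eq_sym.
by case: (val k == 0); case: (val l == 0) => //; rewrite andbCA.
Qed.

Definition big (T : finType) (G : T -> T -> bool) x := 2 < #|[pred y | G x y]|.

Lemma iso_big (T U : finType) (G : T -> T -> bool) (H : U -> U -> bool) f x :
  bijective f -> (forall x y, G x y = H (f x) (f y)) -> big G x = big H (f x).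
Proof.
move=> [g fK gK] h; congr (2 < _); rewrite -(card_image (can_inj fK)).
apply: eq_card => y; apply/imageP/idP => [[z + ->]|]; first by rewrite !inE h.
by rewrite !inE => hy; exists (g y); rewrite ?gK // inE h gK.
Qed.

Lemma big_plain C u : lcn_graph C -> big (plain_of C) u = (val u.2 == 0).
Proof.
move=> [_ _ mate _ _]; case: u => i k; rewrite /big /=; case: eqP => hk.
  (* The three pendant copies of [i] already give degree 3. *)
  apply: (@leq_trans #|[set (i, l) | l in [set~ (ord0 : 'I_4)]]|).
    by rewrite card_imset ?cardsC1 ?card_ord // => l l' [].
  apply/subset_leq_card/subsetP => _ /imsetP[l + ->]; rewrite !inE /plain_of /= hk /= => hl.
  by case: eqP => // e; case/eqP: hl; apply: val_inj.
apply/negbTE; rewrite -leqNgt.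
(* Off layer 0 the only possible neighbours are [(i, 0)] and the copy of the mate [j] on layer 1;
   the default [i] serves when there is no mate. *)
pose j := odflt i [pick j | val (C i j) == 2].
apply: leq_trans (_ : #|[set (i, ord0 : 'I_4); (j, @Ordinal 4 1 isT)]| <= _);
  last by rewrite cards2; case: eqP.
apply/subset_leq_card/subsetP => -[i' k']; rewrite !inE /plain_of /=.
move/eqP/negbTE: hk => ->; case: eqP => [h0 /eqP <-|_ /and3P[_ /eqP h1 /eqP h2]].
  by apply/orP; left; apply/eqP; congr pair; apply: val_inj.
apply/orP; right; apply/eqP; congr pair; last exact: val_inj.
by rewrite /j; case: pickP => [j' /eqP /(mate _ _ _ h2) //|/(_ i')/eqP].
Qed.

Lemma iso_plain C D : iso C D -> iso (plain_of C) (plain_of D).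
Proof.
move=> [f [bf h]]; have fI := bij_inj bf; have [g fK gK] := bf.
exists (fun u => (f u.1, u.2)); split.
  by exists (fun u => (g u.1, u.2)) => -[i k]; rewrite /= ?fK ?gK.
by move=> [i k] [i' k']; rewrite /plain_of /= !h !(inj_eq fI).
Qed.

(** Layer 0 is preserved, but the other copies of a vertex may be permuted, so color 2 must be
    recovered without naming layer 1: some vertices off layer 0, attached to [(i, 0)] and [(j, 0)],
    are adjacent. *)
Lemma plain_iso C D : lcn_graph C -> lcn_graph D ->
  iso (plain_of C) (plain_of D) -> iso C D.
Proof.
move=> lC lD [f [bf h]]; have fI := bij_inj bf; have [g fK gK] := bf.
pose s i := (f (i, ord0)).1.
have fb u : (val (f u).2 == 0) = (val u.2 == 0).
  by rewrite -(big_plain u lC) -(big_plain (f u) lD) (iso_big u bf h).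
have fs i : f (i, ord0) = (s i, ord0).
  have := fb (i, ord0); rewrite /s; case: (f _) => j k /= /eqP e.
  by congr pair; apply: val_inj.
have sI : injective s.
  by move=> i j e; have [] : (i, ord0) = (j, ord0) :> W by apply: fI; rewrite !fs e.
have c1 (E : 'I_n -> 'I_n -> 'I_3) i j :
    (val (E i j) == 1) = plain_of E (i, ord0) (j, ord0) by [].
have c2 (E : 'I_n -> 'I_n -> 'I_3) i j : (val (E i j) == 2) =
    [exists u, exists v, [&& val u.2 != 0, val v.2 != 0, plain_of E u (i, ord0),
       plain_of E v (j, ord0) & plain_of E u v]].
  apply/idP/existsP => [e|[u /existsP[v]]].
    by exists (i, @Ordinal 4 1 isT); apply/existsP; exists (j, @Ordinal 4 1 isT);
      rewrite /plain_of /= !eqxx e.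
  case/and5P=> /negbTE hu /negbTE hv; rewrite /plain_of hu hv /=.
  by move=> /eqP -> /eqP -> /and3P[].
exists s; split; first exact: injF_bij.
move=> i j; apply: enc_color_inj; rewrite /enc_color !c1 h !fs !c2; congr [:: _; _].
apply/existsP/existsP => [[u /existsP[v hv]]|[u /existsP[v hv]]].
  by exists (f u); apply/existsP; exists (f v); rewrite !fb -!fs -!h.
by exists (g u); apply/existsP; exists (g v); rewrite -(fb (g u)) -(fb (g v)) !h !fs !gK.
Qed.

End GraphOfLcn.

(** * Numbering of the pairs *)

Section Coordinates.
Variables n m : nat.

Lemma coord_ltl (u : 'I_(n * m)) : u %/ m < n.
Proof. by rewrite ltn_divLR //; case: m u => // -[u]; rewrite muln0. Qed.

Lemma coord_ltr (u : 'I_(n * m)) : u %% m < m.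
Proof. by rewrite ltn_mod; case: m u => // -[u]; rewrite muln0. Qed.

Definition coord (u : 'I_(n * m)) : 'I_n * 'I_m := (Ordinal (coord_ltl u), Ordinal (coord_ltr u)).

Lemma coord_bij : bijective coord.
Proof.
apply: inj_surj_bij => [u v [e1 e2]|[i k]].
  by apply: ord_inj; rewrite (divn_eq u m) (divn_eq v m) e1 e2.
have m0 : 0 < m by case: m k => // -[].
have hu : i * m + k < n * m.
  apply: leq_trans (_ : i.+1 * m <= _); first by rewrite mulSn addnC ltn_add2r.
  by rewrite leq_mul2r ltn_ord orbT.
exists (Ordinal hu); apply/eqP; congr pair; apply: ord_inj => /=.
  by rewrite divnMDl // divn_small ?addn0.
by rewrite modnMDl modn_small.
Qed.

End Coordinates.

Definition lcn_label n (k : 'I_(n + 2)) : 'I_n + bool :=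
  match split k with inl k' => inl k' | inr b => inr (val b == 1) end.

Lemma lcn_label_bij n : bijective (@lcn_label n).
Proof.
pose h (x : 'I_n + bool) : 'I_(n + 2) :=
  unsplit (match x with inl k => inl k | inr b => inr (inord b) end).
exists h => [k|[k|b]]; rewrite /lcn_label /h ?unsplitK //=; last by rewrite inordK; case: b.
rewrite -[RHS]splitK; case: (split k) => // b; congr (unsplit (inr _)).
by apply: ord_inj; rewrite /= inordK; case: b => -[|[|]].
Qed.

Lemma iso_pull (T U X : Type) (f : T -> U) (G : U -> U -> X) :
  bijective f -> iso (fun x y => G (f x) (f y)) G.
Proof. by move=> bf; exists f. Qed.

Definition lcn_coord n (u : 'I_(n * (n + 2))) : 'I_n * ('I_n + bool) :=
  ((coord u).1, lcn_label (coord u).2).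

Lemma lcn_coord_bij n : bijective (@lcn_coord n).
Proof.
have [g gK hK] := @lcn_label_bij n.
have := bij_comp (_ : bijective (fun u : 'I_n * 'I_(n + 2) => (u.1, lcn_label u.2))) (@coord_bij n (n + 2)).
by apply; exists (fun u => (u.1, g u.2)) => -[i k] /=; rewrite ?gK ?hK.
Qed.

Section GraphToLcnCorrect.
Variables (n : nat) (A : nat -> nat -> bool).

Let Ao : 'I_n -> 'I_n -> bool := fun i j => A i j.

Lemma lcn_bitsE (u v : 'I_(n * (n + 2))) :
  lcn_bits n A (u %/ (n + 2)) (u %% (n + 2)) (v %/ (n + 2)) (v %% (n + 2)) =
  enc_color (lcn_of Ao (lcn_coord u) (lcn_coord v)).
Proof.
rewrite /enc_color lcn_of1 lcn_of2 /lcn_bits.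
have incE (x y : 'I_(n * (n + 2))) :
    inc n A (x %/ (n + 2)) (x %% (n + 2)) (y %/ (n + 2)) (y %% (n + 2)) =
    incident Ao (lcn_coord x) (lcn_coord y).
  rewrite /inc /incident /lcn_coord /lcn_label /=.
  case: splitP => /= k ->; last by rewrite ltnNge leq_addr.
  case: splitP => /= k' ->; rewrite ltn_ord /=; first by rewrite ltn_eqF.
  by case: k' => -[|[|]] //= hk'; rewrite ?addn0 ?eqxx // addn1 eqn_leq ltnn.
congr [:: _; _]; first by rewrite !incE.
rewrite /opposite /lcn_coord /lcn_label /=.
have neq (k : 'I_n) c : (k == n + c :> nat) = false by have := ltn_ord k; lia.
have neq0 (k : 'I_n) : (k == n :> nat) = false by have := ltn_ord k; lia.
case: splitP => /= k ->; first by rewrite neq0 neq andbF.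
case: splitP => /= k' ->; first by rewrite neq0 neq /= !andbF.
by congr andb; case: k k' => -[|[|]] // hk [[|[|]]] // hk' /=; lia.
Qed.

Lemma enc_pairs_lcn : enc_pairs n (n + 2) (lcn_bits n A) =
  enc_cgraph (fun u v : 'I_(n * (n + 2)) => lcn_of Ao (lcn_coord u) (lcn_coord v)).
Proof. by rewrite enc_pairsE; apply/esym/enc_cgraphE => u v; rewrite lcn_bitsE. Qed.

End GraphToLcnCorrect.

Lemma enc_pairs_plain n (c1 c2 : nat -> nat -> bool) (C : 'I_n -> 'I_n -> 'I_3) :
  (forall i j : 'I_n, c1 i j = (val (C i j) == 1)) ->
  (forall i j : 'I_n, c2 i j = (val (C i j) == 2)) ->
  enc_pairs n 4 (fun i k i' k' => [:: plain_bit c1 c2 i k i' k']) =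
  enc_graph (fun u v : 'I_(n * 4) => plain_of C (coord u) (coord v)).
Proof.
move=> h1 h2; rewrite enc_pairsE; apply/esym/enc_graphE => u v.
have c1E := h1 (coord u).1 (coord v).1; have c2E := h2 (coord u).1 (coord v).1.
by rewrite /plain_of /plain_bit -c1E -c2E.
Qed.

Lemma GraphToLcn_correct w : GI w <-> GI_SAT (sem w GraphToLcn (fun=> 0)).2.
Proof.
rewrite sem_GraphToLcn /=.
set n := index false w; set A := entry 1 _ _ _ w; set B := entry 1 _ _ _ w.
case: (boolP (formatted 1 w)) => [|/negP nf] /=; last first.
  by split=> [/GI_formatted //|/not_GI_SAT_nil].
move=> /formattedP /= wE.
have {}wE : w = enc_graph (fun i j : 'I_n => A i j) ++ enc_graph (fun i j : 'I_n => B i j).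
  by rewrite {1}wE !(@enc_graphE n _ _ (fun i j => erefl)).
rewrite {1}wE GI_enc.
case: (boolP (bad_graph n A)) => [bA|/bad_graphP sA] /=.
  by split=> [[/bad_graphP]|/not_GI_SAT_nil //]; rewrite bA.
case: (boolP (bad_graph n B)) => [bB|/bad_graphP sB] /=.
  by split=> [[_ /bad_graphP]|/not_GI_SAT_nil //]; rewrite bB.
rewrite !enc_pairs_lcn GI_SAT_enc.
have pull E := iso_pull (@lcn_of n E) (lcn_coord_bij n).
split=> [[_ _ iAB]|[_ _ iCC]].
  split; [exact: iso_lcn_graph (pull _) (lcn_graph_of _)..|].
  exact: iso_trans (pull _) (iso_trans (iso_lcn_of iAB) (iso_sym (pull _))).
split=> //; apply: lcn_of_iso => //.
exact: iso_trans (iso_sym (pull _)) (iso_trans iCC (pull _)).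
Qed.

(** Members pass all checks of the program. This is shown before decoding because a formatted word
    with 2-bit entries may contain the pair 11 and then encodes no colored graph. *)
Lemma GI_SAT_reads w : GI_SAT w ->
  let n := index false w in
  let good b := ~~ bad_cgraph n (entry 2 n b 0 w) (entry 2 n b 1 w) in
  [/\ formatted 2 w, good (n + 1) & good (block_size 2 n + (n + 1))].
Proof.
move=> [n [m [C [D [-> [/lcn_graphP lC [/lcn_graphP lD iCD]]]]]]].
have nm := iso_ord_eq iCD; subst m; rewrite !enc_cgraph_nat index_encb /=.
have hC : forall i j, i < n -> j < n -> size (enc_color (nat_ext ord0 C i j)) = 2 by [].
have hD : forall i j, i < n -> j < n -> size (enc_color (nat_ext ord0 D i j)) = 2 by [].
have eC := entry_encb hC [::] (encb n (fun i j => enc_color (nat_ext ord0 D i j))).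
have eD := entry_encb hD (encb n (fun i j => enc_color (nat_ext ord0 C i j))) [::].
rewrite (size_encb hC) cats0 in eD; rewrite cat0s add0n in eC.
split; first exact: formatted_encb.
  by apply/(bad_cgraphP (C := C)) => // i j; rewrite eC // nat_extE.
by apply/(bad_cgraphP (C := D)) => // i j; rewrite eD // nat_extE.
Qed.

Lemma bad_cgraph_excl n c1 c2 (i j : 'I_n) :
  ~~ bad_cgraph n c1 c2 -> ~~ (c1 i j && c2 i j).
Proof.
rewrite /bad_cgraph negb_or has_ord => /andP[/existsPn/(_ i) + _].
by rewrite has_ord => /existsPn/(_ j); rewrite negb_or => /andP[].
Qed.

Lemma LcnToGraph_correct w : GI_SAT w <-> GI (sem w LcnToGraph (fun=> 0)).2.
Proof.
rewrite sem_LcnToGraph /=; have reads := @GI_SAT_reads w; move: reads => /=.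
set n := index false w.
set c1 := entry 2 n (n + 1) 0 w; set c2 := entry 2 n (n + 1) 1 w.
set d1 := entry 2 n _ 0 w; set d2 := entry 2 n _ 1 w => reads.
case: ifP => [/and3P[/formattedP /= wE gC gD]|h]; last first.
  by split=> [/reads[h1 h2 h3]|/not_GI_nil //]; rewrite h1 h2 h3 in h.
pose C := fun i j : 'I_n => color (c1 i j) (c2 i j).
pose D := fun i j : 'I_n => color (d1 i j) (d2 i j).
have C1 (i j : 'I_n) : c1 i j = (val (C i j) == 1) by rewrite color1.
have D1 (i j : 'I_n) : d1 i j = (val (D i j) == 1) by rewrite color1.
have C2 (i j : 'I_n) : c2 i j = (val (C i j) == 2) by rewrite color2 // bad_cgraph_excl.
have D2 (i j : 'I_n) : d2 i j = (val (D i j) == 2) by rewrite color2 // bad_cgraph_excl.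
have lC : lcn_graph C by apply/(bad_cgraphP C1 C2).
have lD : lcn_graph D by apply/(bad_cgraphP D1 D2).
have {}wE : w = enc_cgraph C ++ enc_cgraph D.
  rewrite {1}wE; congr (_ ++ _); apply/esym/enc_cgraphE => i j.
    by rewrite enc_color_color ?bad_cgraph_excl.
  by rewrite enc_color_color ?bad_cgraph_excl.
rewrite {1}wE GI_SAT_enc (enc_pairs_plain C1 C2) (enc_pairs_plain D1 D2) GI_enc.
have pull E := iso_pull (@plain_of n E) (@coord_bij n 4).
have simple E : lcn_graph E ->
    simple_graph (fun u v : 'I_(n * 4) => plain_of E (coord u) (coord v)).
  by move=> /plain_simple[s ir]; split.
split=> [[_ _ iCD]|[_ _ iPP]].
  split; [exact: simple..|].
  exact: iso_trans (pull _) (iso_trans (iso_plain iCD) (iso_sym (pull _))).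
split=> //; apply: plain_iso => //.
exact: iso_trans (iso_sym (pull _)) (iso_trans iPP (pull _)).
Qed.

Theorem theorem6 : poly_reducible GI GI_SAT /\ poly_reducible GI_SAT GI.
Proof.
split.
- exists (fun w => (sem w GraphToLcn (fun=> 0)).2).
  by split; [exact: prog_poly_time well_scoped_GraphToLcn | exact: GraphToLcn_correct].
- exists (fun w => (sem w LcnToGraph (fun=> 0)).2).
  by split; [exact: prog_poly_time well_scoped_LcnToGraph | exact: LcnToGraph_correct].
Qed.
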